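(* (Classification of fourth order operators.) Let $L=a_4(x)D^4+a_3(x)D^3+a_2(x)D^2+a_1(x)D$, where $D=d/dx$, each $a_k$ is a real polynomial of degree at most $k$, and $a_4\not\equiv0$. The self-adjoint operators $L$ of this form with an admissible weight $p$ on an interval $I$ are exactly the following, where $L$ is taken up to multiplication by a nonzero constant and, in cases (B) and (C), up to an affine change of the variable $x$; $\lambda_n$ denotes the eigenvalue of $L$ in degree $n$ (the coefficient of $x^n$ in $L(x^n)$), $n=0,1,2,\dots$, and $p$ is determined up to a positive constant factor. (A) $a_4$ has no real roots. Then $I=(-\infty,\infty)$ and, for real parameters $m_0,m_1,m_2,A$ with $m_2\neq0$, $$p(x)=e^{-m_2^2x^2+m_1x+m_0},\quad a_4=1,\quad a_3=2(m_1-2m_2^2x),$$ $$a_2=4m_2^4x^2-4m_1m_2^2x+A,\quad a_1=(-m_1^2+2m_2^2+A)(m_1-2m_2^2x),$$ $$\lambda_n=2m_2^2\big(m_1^2-A+2m_2^2(n-2)\big)n.$$ (B) $a_4$ has only one real root. Then, for real parameters $a,b,A$ with $a>2$, $b<0$, $I=(0,\infty)$ and $$p(x)=|x|^{\frac a2-2}e^{\frac b2x},\quad a_4=x^2,\quad a_3=x(a+bx),$$ $$a_2=\tfrac14\big[-2a+a^2+x(4A+b^2x)\big],\quad a_1=\tfrac14(2A-ab)(-2+a+bx),$$ $$\lambda_n=\tfrac b4\,n\,(2A-ab-b+bn).$$ (C) $a_4$ has more than one real root. Then $I=(-1,1)$ and, for real parameters $a,b$ with $b-a>0$ and $b+a<0$,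 $$p(x)=(1-x)^{\frac12(-2-a-b)}(1+x)^{\frac12(-2-a+b)},\quad a_4=(1-x^2)^2,\quad a_3=-2\big(b+(a-2)x\big)(x^2-1),$$ together with, if $b=0$ (so $a<0$), for a real parameter $A$, $$a_2=-2a+a^2+A(x^2-1),\quad a_1=a(2-3a+a^2-A)x,$$ $$\lambda_n=n(-a+n-1)(-a^2-na+4a+n^2+A-n-2),$$ and, if $b\neq0$, for a real parameter $B$, $$a_2=\frac{b^3+B+2(a-1)b^2x-Bx^2+b(-2+a+2x^2-3ax^2+a^2x^2)}{b},\quad a_1=B+\frac{aB}{b}x,$$ $$\lambda_n=\frac{(a-n+1)\,n\,(-bn^2+abn+bn-ab+B)}{b}.$$
   Context: $I$ is an open interval with (possibly infinite) endpoints which contains no zero of $a_4$ and whose finite endpoints are zeros of $a_4$. The weight is $p(x)=\frac{1}{|a_4(x)|}\exp\big(\frac12\int\frac{a_3(x)}{a_4(x)}dx\big)$ on $I$; it is admissible if $\int_I p|u|\,dx<\infty$ for every polynomial $u$. $L$ is self-adjoint (with respect to $\langle u,v\rangle=\int_I puv\,dx$) when it satisfies the determining equations $$(a_4p)'=\tfrac12(a_3p),\qquad (a_3p)''-2(a_2p)'+2(a_1p)=0\quad\text{on } I,$$ subject to the vanishing (as one-sided limits) of $a_4p$, $a_3p$ and $(a_2p)-\tfrac12(a_3p)'$ at both endpoints of $I$. *)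

(* Defs.v *)
From HB Require Import structures.
From mathcomp Require Import all_boot all_order all_algebra.
From mathcomp Require Import all_classical all_reals all_analysis.
Import Order.TTheory GRing.Theory Num.Theory.
Import numFieldNormedType.Exports.

Set Implicit Arguments.
Unset Strict Implicit.
Unset Printing Implicit Defensive.

Local Open Scope classical_set_scope.
Local Open Scope ring_scope.

(* The coefficients of a4 D^4 + a3 D^3 + a2 D^2 + a1 D. *)
Record diffop (R : realType) := DiffOp {
  a4 : {poly R}; a3 : {poly R}; a2 : {poly R}; a1 : {poly R} }.

Section Operators.
Variable R : realType.
Implicit Types (L M : diffop R) (l r : \bar R) (p w : R -> R) (I J : set R).

Definition diffop_app L (u : {poly R}) : {poly R} :=
  a4 L * derivn 4 u + a3 L * derivn 3 u + a2 L * derivn 2 u + a1 L * deriv u.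

Definition admissible_form L : Prop :=
  [/\ (size (a4 L) <= 5)%N, (size (a3 L) <= 4)%N, (size (a2 L) <= 3)%N,
      (size (a1 L) <= 2)%N & a4 L != 0].

Definition eigval L (n : nat) : R := (diffop_app L 'X^n)`_n.

(* The open interval of endpoints l < r is represented by its two endpoints
   in the extended real line. *)
Definition itv_of l r : set R := [set x : R | (l < x%:E)%E /\ (x%:E < r)%E].

(* In an interval with l < r, l is not +oo and r is not -oo: the last branch
   of each of these two definitions is then only used for l = -oo, resp.
   r = +oo. *)
Definition lower_end l : set_system R :=
  match l with x%:E => at_right x | _ => ninfty_nbhs R end%E.
Definition upper_end r : set_system R :=
  match r with x%:E => at_left x | _ => pinfty_nbhs R end%E.

Definition interval_for L l r : Prop :=
  [/\ (l < r)%E,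
      (forall x, itv_of l r x -> ~~ root (a4 L) x),
      (forall x : R, l = x%:E -> root (a4 L) x) &
      (forall x : R, r = x%:E -> root (a4 L) x)].

(* p = |a4|^-1 exp (F / 2) on I, F being any antiderivative of a3 / a4. *)
Definition weight_of L I p : Prop :=
  exists F : R -> R,
    (forall x, I x -> is_derive x 1 F ((a3 L).[x] / (a4 L).[x])) /\
    (forall x, I x -> p x = `|(a4 L).[x]|^-1 * expR (F x / 2)).

Definition admissible I p : Prop :=
  forall u : {poly R},
    (\int[@lebesgue_measure R]_(x in I) (p x * `|u.[x]|)%:E < +oo)%E.

Definition determining_eqs L I p : Prop :=
  (forall x, I x ->
     derive1 (fun y => (a4 L).[y] * p y) x = ((a3 L).[x] * p x) / 2) /\
  (forall x, I x ->
     derive1n 2 (fun y => (a3 L).[y] * p y) x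
     - 2 * derive1 (fun y => (a2 L).[y] * p y) x
     + 2 * ((a1 L).[x] * p x) = 0).

Definition vanishing_at L p (F : set_system R) : Prop :=
  [/\ (a4 L).[x] * p x @[x --> F] --> (0 : R),
      (a3 L).[x] * p x @[x --> F] --> (0 : R) &
      (a2 L).[x] * p x - derive1 (fun y => (a3 L).[y] * p y) x / 2
        @[x --> F] --> (0 : R)].

Definition selfadjoint L l r p : Prop :=
  [/\ determining_eqs L (itv_of l r) p,
      vanishing_at L p (lower_end l) & vanishing_at L p (upper_end r)].

Definition selfadjoint_admissible L l r p : Prop :=
  [/\ admissible_form L, interval_for L l r, weight_of L (itv_of l r) p,
      admissible (itv_of l r) p & selfadjoint L l r p].

(* Change of variable x = alpha * t + beta: a function u of x becomes the
   function u \Po affX alpha beta of t. *)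
Definition affX (alpha beta : R) : {poly R} := alpha *: 'X + beta%:P.

(* Up to a nonzero constant factor for the operators, a positive constant
   factor for the weights and the change of variable x = alpha * t + beta,
   the operator L on I with weight p is M on J with weight w. *)
Definition same_upto_affine L I p M J w : Prop :=
  exists alpha beta c k : R,
    [/\ [/\ alpha != 0, c != 0 & 0 < k],
        I = [set alpha * t + beta | t in J],
        (forall t, J t -> p (alpha * t + beta) = k * w t) &
        (forall u : {poly R}, diffop_app L u \Po affX alpha beta =
                              c *: diffop_app M (u \Po affX alpha beta))].

Definition no_real_root (q : {poly R}) : Prop := forall x, ~~ root q x.
Definition one_real_root (q : {poly R}) : Prop := exists! x, root q x.
Definition several_real_roots (q : {poly R}) : Prop :=
  exists x y, [/\ x != y, root q x & root q y].

Definition wA (m0 m1 m2 x : R) : R :=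
  expR (- (m2 ^+ 2 * x ^+ 2) + m1 * x + m0).

Definition opA (m1 m2 A : R) : diffop R := {|
  a4 := 1;
  a3 := 2 *: (m1%:P - (2 * m2 ^+ 2) *: 'X);
  a2 := (4 * m2 ^+ 4) *: 'X^2 - (4 * m1 * m2 ^+ 2) *: 'X + A%:P;
  a1 := (- m1 ^+ 2 + 2 * m2 ^+ 2 + A) *: (m1%:P - (2 * m2 ^+ 2) *: 'X) |}.

Definition lambdaA (m1 m2 A : R) (n : nat) : R :=
  2 * m2 ^+ 2 * (m1 ^+ 2 - A + 2 * m2 ^+ 2 * (n%:R - 2)) * n%:R.

Definition paramB (a b : R) : Prop := 2 < a /\ b < 0.

Definition wB (a b x : R) : R := `|x| `^ (a / 2 - 2) * expR (b / 2 * x).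

Definition opB (a b A : R) : diffop R := {|
  a4 := 'X^2;
  a3 := 'X * (a%:P + b *: 'X);
  a2 := 4^-1 *: ((- (2 * a) + a ^+ 2)%:P
                 + 'X * ((4 * A)%:P + (b ^+ 2) *: 'X));
  a1 := (4^-1 * (2 * A - a * b)) *: ((- 2 + a)%:P + b *: 'X) |}.

Definition lambdaB (a b A : R) (n : nat) : R :=
  b / 4 * n%:R * (2 * A - a * b - b + b * n%:R).

Definition paramC (a b : R) : Prop := 0 < b - a /\ b + a < 0.

Definition wC (a b x : R) : R :=
  (1 - x) `^ ((- 2 - a - b) / 2) * (1 + x) `^ ((- 2 - a + b) / 2).

Definition a4C : {poly R} := (1 - 'X^2) ^+ 2.
Definition a3C (a b : R) : {poly R} :=
  (- 2) *: ((b%:P + (a - 2) *: 'X) * ('X^2 - 1)).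

(* The value of the parameter b is 0 in opC0; opC is meant for b != 0. *)
Definition opC0 (a A : R) : diffop R := {|
  a4 := a4C;
  a3 := a3C a 0;
  a2 := (- (2 * a) + a ^+ 2)%:P + A *: ('X^2 - 1);
  a1 := (a * (2 - 3 * a + a ^+ 2 - A)) *: 'X |}.

Definition lambdaC0 (a A : R) (n : nat) : R :=
  n%:R * (- a + n%:R - 1)
  * (- a ^+ 2 - n%:R * a + 4 * a + n%:R ^+ 2 + A - n%:R - 2).

Definition opC (a b B : R) : diffop R := {|
  a4 := a4C;
  a3 := a3C a b;
  a2 := b^-1 *: ((b ^+ 3 + B)%:P + (2 * (a - 1) * b ^+ 2) *: 'X - B *: 'X^2
                 + b *: ((- 2 + a)%:P + 2 *: 'X^2 - (3 * a) *: 'X^2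
                         + (a ^+ 2) *: 'X^2));
  a1 := B%:P + (a * B / b) *: 'X |}.

Definition lambdaC (a b B : R) (n : nat) : R :=
  (a - n%:R + 1) * n%:R
  * (- (b * n%:R ^+ 2) + a * b * n%:R + b * n%:R - a * b + B) / b.

Definition caseA L I p : Prop :=
  [/\ no_real_root (a4 L),
      I = setT &
      exists m0 m1 m2 A c : R,
        [/\ m2 != 0, c != 0,
            (forall x, p x = wA m0 m1 m2 x) &
            (forall u, diffop_app L u = c *: diffop_app (opA m1 m2 A) u)]].

Definition caseB L I p : Prop :=
  one_real_root (a4 L) /\
  exists a b A : R,
    paramB a b /\ same_upto_affine L I p (opB a b A) `]0, +oo[ (wB a b).

Definition caseC L I p : Prop :=
  several_real_roots (a4 L) /\
  exists a b : R,
    paramC a b /\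
    ((b = 0 /\ exists A : R,
        same_upto_affine L I p (opC0 a A) `](-1), 1[ (wC a b)) \/
     (b != 0 /\ exists B : R,
        same_upto_affine L I p (opC a b B) `](-1), 1[ (wC a b))).

End Operators.

(* Main.v *)
Require Import Defs.
From mathcomp Require Import all_boot all_order all_algebra.
From mathcomp Require Import all_classical all_reals all_analysis.
From mathcomp Require Import measurable_realfun polyrcf zify ring lra.
Import Order.TTheory GRing.Theory Num.Theory.
Import numFieldNormedType.Exports.

Set Implicit Arguments.
Unset Strict Implicit.
Unset Printing Implicit Defensive.

Local Open Scope classical_set_scope.
Local Open Scope ring_scope.

(** Write p' = p rho with rho = (a3 - 2 a4') / (2 a4). Then
    a2 p - (a3 p)' / 2 = N p / (4 a4) for the polynomial
    N = 4 a4 a2 - 2 a4 a3' + 2 a4' a3 - a3 ^ 2, and the second determining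
    equation says that the derivative of this function is a1 p, that is,
      2 a4 N' + N (a3 - 4 a4') = 8 a4 ^ 2 a1.
    This identity no longer involves the weight, so that it holds as an identity
    between polynomials, on the whole line (moment_eq, reducedP). Everything
    follows from comparing it with the behaviour of p at the two endpoints.

    At a finite endpoint x, where a4 vanishes, a positive function whose
    logarithmic derivative has at x at most a simple pole, with nonpositive
    residue, does not tend to 0 there (not_lower0). If x were a simple zero of
    a4, the identity above would leave three possible exponents for p at x, each
    of which contradicts one of the three vanishing conditions. Hence a4 has a
    double zero, a3 vanishes, and if a4''(x) is not 0 then p ~ |y - x| ^ m with
    m > -1 and N vanishes to the third order (lower_end_zeros,
    lower_end_double).

    At an infinite endpoint, finite moments forbid deg a3 < deg a4, for then p
    would decay like a power. The vanishing of a4 p determines the sign of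
    a3 / a4 near infinity, and the leading terms of the identity force
    2 deg a3 <= deg a4 + 2 (upper_infinite_growth, upper_infinite_sign,
    upper_infinite_degrees).

    Two finite endpoints therefore give a4 = c (y - x1) ^ 2 (y - x2) ^ 2, one
    finite endpoint gives a4 = c (y - x) ^ 2, and none gives a constant a4. As
    the problem is affinely invariant (reduced_affine), it suffices to work on
    the intervals (-1, 1), (0, oo) and the line; there the identity determines
    N, hence a2 and a1, up to one parameter, and the logarithmic derivative
    determines p up to a constant (reduced_segment, reduced_half_line,
    reduced_line). Conversely the three models satisfy every condition; the only
    analytic point is the finiteness of the moments, for which the integrands
    are bounded by derivatives of bounded functions. *)

(** * Derivatives and open intervals *)

Section Calculus.
Variable R : realType.
Implicit Types (f g : R -> R) (x y : R) (P Q : {poly R}).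

Lemma is_derive_horner P x : is_derive x 1 (horner P) P^`().[x].
Proof.
rewrite derivE derive1E; apply: derivableP; exact: derivable_horner.
Qed.

Lemma is_derive_mul f g x a b : is_derive x 1 f a -> is_derive x 1 g b ->
  is_derive x 1 (fun y => f y * g y) (a * g x + f x * b).
Proof.
move=> df dg; apply: (is_derive_eq (is_deriveM df dg)).
by rewrite addrC /GRing.scale /= (mulrC (g x)).
Qed.

Lemma is_derive_add f g x a b : is_derive x 1 f a -> is_derive x 1 g b ->
  is_derive x 1 (fun y => f y + g y) (a + b).
Proof. by move=> df dg; exact: (is_deriveD df dg). Qed.

Lemma is_derive_opp f x a : is_derive x 1 f a ->
  is_derive x 1 (fun y => - f y) (- a).
Proof. by move=> df; exact: (is_deriveN df). Qed.

Lemma is_derive_cmul c f x a : is_derive x 1 f a ->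
  is_derive x 1 (fun y => c * f y) (c * a).
Proof. by move=> df; exact: (is_deriveZ c df). Qed.

Lemma is_derive_inv f x a : f x != 0 -> is_derive x 1 f a ->
  is_derive x 1 (fun y => (f y)^-1) (- a / f x ^+ 2).
Proof.
move=> fx df; apply: (is_derive_eq (is_deriveV fx df)).
by rewrite /GRing.scale /= mulNr mulrC mulNr.
Qed.

Lemma is_derive_affine f x alpha beta a :
  is_derive (alpha * x + beta) 1 f a ->
  is_derive x 1 (fun y => f (alpha * y + beta)) (alpha * a).
Proof.
move=> df; rewrite mulrC.
apply: (is_derive1_comp (g := fun y => alpha * y + beta)) => //.
have dx : is_derive x 1 (fun y => alpha * y + beta) (alpha * 1 + 0).
  by apply: is_derive_add; apply: is_derive_cmul.
by rewrite mulr1 addr0 in dx.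
Qed.

Lemma derivative_ge0_homo f df x y : x <= y ->
  (forall z, x <= z <= y -> is_derive z 1 f (df z)) ->
  (forall z, x <= z <= y -> 0 <= df z) -> f x <= f y.
Proof.
move=> xy f' df0.
have [||z] := @MVT_segment R f df x y xy.
- move=> z; rewrite in_itv /= => /andP[xz zy]; apply: f'.
  by rewrite !ltW.
- apply: derivable_within_continuous => z; rewrite in_itv /= => zI.
  exact: (@ex_derive _ _ _ _ _ _ _ (f' z zI)).
rewrite in_itv /= => /df0 dz fxy; rewrite -subr_ge0 fxy mulr_ge0// subr_ge0//.
Qed.


Lemma poly_ext P Q : (forall x, P.[x] = Q.[x]) -> P = Q.
Proof.
move=> PQ; apply/eqP; rewrite -subr_eq0; apply/negPn/negP => PQ0.
pose rs := [seq (i%:R : R) | i <- iota 0 (size (P - Q))].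
have := max_poly_roots (rs := rs) PQ0.
rewrite size_map size_iota ltnn => /(_ _ _)/negP; apply => //.
- by apply/allP => x _; rewrite /root !hornerE PQ subrr.
- by rewrite map_inj_uniq ?iota_uniq// => i j /eqP; rewrite eqr_nat => /eqP.
Qed.

Lemma itv_of_nonempty (l r : \bar R) : (l < r)%E -> exists x, itv_of l r x.
Proof.
case: l r => [l| |] [r| |] //=; rewrite /itv_of/=.
- rewrite lte_fin => lr; exists ((l + r) / 2); rewrite !lte_fin.
  by rewrite !midf_lt.
- by move=> _; exists (l + 1); rewrite lte_fin ltrDl ltr01 ltry.
- by move=> _; exists (r - 1); rewrite lte_fin ltrBlDr ltrDl ltr01 ltNyr.
- by move=> _; exists 0; rewrite ltNyr ltry.
Qed.

Lemma itv_of_convex (l r : \bar R) x y z :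
  itv_of l r x -> itv_of l r y -> x <= z <= y -> itv_of l r z.
Proof.
move=> [lx _] [_ yr] /andP[xz zy]; split.
- by apply: lt_le_trans lx _; rewrite lee_fin.
- by apply: le_lt_trans yr; rewrite lee_fin.
Qed.

Lemma itv_of_open (l r : \bar R) : open (itv_of l r).
Proof.
have -> : itv_of l r = [set x : R | (l < x%:E)%E] `&` [set x : R | (x%:E < r)%E] by [].
apply: openI.
- case: l => [l| |] /=.
  + have -> : [set x : R | (l%:E < x%:E)%E] = [set x | l < x] by [].
    exact: open_gt.
  + have -> : [set x : R | (+oo < x%:E)%E] = set0 by apply/seteqP; split.
    exact: open0.
  + have -> : [set x : R | (-oo < x%:E)%E] = setT.
      by apply/seteqP; split => // x _ /=; rewrite ltNyr.
    exact: openT.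
- case: r => [r| |] /=.
  + have -> : [set x : R | (x%:E < r%:E)%E] = [set x | x < r] by [].
    exact: open_lt.
  + have -> : [set x : R | (x%:E < +oo)%E] = setT.
      by apply/seteqP; split => // x _ /=; rewrite ltry.
    exact: openT.
  + have -> : [set x : R | (x%:E < -oo)%E] = set0 by apply/seteqP; split.
    exact: open0.
Qed.

Lemma poly_eq_on_itv P Q l r : (l < r)%E ->
  (forall x, itv_of l r x -> P.[x] = Q.[x]) -> P = Q.
Proof.
move=> lr PQ.
have [x0 I0] := itv_of_nonempty lr.
have [y0 xy0 Iy] : exists2 y0, x0 < y0 & itv_of l r y0.
  have [lx xr] := I0.
  have [y [Ly Yr]] := itv_of_nonempty xr; exists y; first by rewrite -lte_fin.
  by split=> //; exact: lt_trans lx Ly.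
apply/eqP; rewrite -subr_eq0; apply/negPn/negP => PQ0.
pose f (i : nat) := x0 + (y0 - x0) / i.+1%:R.
pose rs := [seq f i | i <- iota 0 (size (P - Q))].
have := max_poly_roots (rs := rs) PQ0.
rewrite size_map size_iota ltnn => /(_ _ _)/negP; apply => //.
- apply/allP => _ /mapP[i _ ->]; rewrite /root !hornerE PQ ?subrr//.
  apply: itv_of_convex I0 Iy _; rewrite /f lerDl divr_ge0 ?subr_ge0 ?(ltW xy0)//=.
  by rewrite -lerBrDl ler_pdivrMr// ler_peMr ?subr_ge0 ?(ltW xy0)// ler1n.
- rewrite map_inj_uniq ?iota_uniq// => i j /addrI/mulfI.
  rewrite subr_eq0 gt_eqF// => /(_ isT)/invr_inj/eqP.
  by rewrite eqr_nat eqSS => /eqP.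
Qed.

(** Two antiderivatives of the same function on an interval differ by a
    constant; here for logarithms. *)
Lemma eq_logderivative f g rho l r : (l < r)%E ->
  (forall x, itv_of l r x -> 0 < f x /\ is_derive x 1 f (f x * rho x)) ->
  (forall x, itv_of l r x -> 0 < g x /\ is_derive x 1 g (g x * rho x)) ->
  exists2 k, 0 < k & forall x, itv_of l r x -> f x = k * g x.
Proof.
move=> lr f' g'.
have d x : itv_of l r x -> is_derive x 1 (fun y => f y * (g y)^-1) 0.
  move=> Ix; have [f0 df] := f' x Ix; have [g0 dg] := g' x Ix.
  have gx : g x != 0 by rewrite gt_eqF.
  apply: (is_derive_eq (is_derive_mul df (is_derive_inv gx dg))).
  by field; rewrite gt_eqF.
have [x0 I0] := itv_of_nonempty lr.
exists (f x0 * (g x0)^-1).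
  by have [? _] := f' x0 I0; have [? _] := g' x0 I0; rewrite mulr_gt0 ?invr_gt0.
have le x y : x <= y -> itv_of l r x -> itv_of l r y ->
    f x * (g x)^-1 = f y * (g y)^-1.
  move=> xy Ix Iy; apply/eqP; rewrite eq_le; apply/andP; split.
    apply: (@derivative_ge0_homo (fun y => f y * (g y)^-1) (fun=> 0)) => //.
    by move=> z /(itv_of_convex Ix Iy)/d.
  rewrite -lerN2.
  apply: (@derivative_ge0_homo (fun y => - (f y * (g y)^-1)) (fun=> 0)) => //.
  by move=> z /(itv_of_convex Ix Iy)/d/is_derive_opp; rewrite oppr0.
move=> x Ix; have [g0 _] := g' x Ix.
suff -> : f x0 * (g x0)^-1 = f x * (g x)^-1 by rewrite divfK// gt_eqF.
by have [/le|/ltW/le] := leP x0 x; [apply|move=> ->].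
Qed.

End Calculus.

(** * Elimination of the derivatives of the weight *)

Section Reduction.
Variable R : realType.
Implicit Types (f g p : R -> R) (x y : R) (P : {poly R}) (l r : \bar R) (L : diffop R).

Lemma derive1_is_derive f x a : is_derive x 1 f a -> derive1 f x = a.
Proof. by move=> df; rewrite derive1E; exact: (@derive_val _ _ _ _ _ _ _ df). Qed.

Lemma is_derive_continuous f x a : is_derive x 1 f a -> {for x, continuous f}.
Proof.
move=> df; apply: differentiable_continuous; apply/derivable1_diffP.
exact: (@ex_derive _ _ _ _ _ _ _ df).
Qed.

Lemma is_derive_eq_on_itv l r f g x a : itv_of l r x ->
  (forall y, itv_of l r y -> f y = g y) -> is_derive x 1 g a ->
  is_derive x 1 f a.
Proof.
move=> Ix fg; apply: near_eq_is_derive.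
near=> y; apply/esym/fg; near: y.
by apply: open_nbhs_nbhs; split=> //; exact: itv_of_open.
Unshelve. all: by end_near. Qed.

Lemma is_derive_norm f x a : f x != 0 -> is_derive x 1 f a ->
  is_derive x 1 (fun y => `|f y|) (Num.sg (f x) * a).
Proof.
move=> fx df; have cf := is_derive_continuous df.
apply: near_eq_is_derive (is_derive_cmul (Num.sg (f x)) df).
have [f0|f0|/eqP] := ltrgt0P (f x); last by rewrite (negPf fx).
- near=> y; rewrite gtr0_sg// mul1r gtr0_norm//; near: y.
  exact: (cvgr_gt _ cf).
- near=> y; rewrite ltr0_sg// mulN1r ltr0_norm//; near: y.
  exact: (cvgr_lt _ cf).
Unshelve. all: by end_near. Qed.

(** The logarithmic derivative p' / p prescribed by the weight. *)
Definition logder L x : R :=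
  ((a3 L).[x] - 2 * (a4 L)^`().[x]) / (2 * (a4 L).[x]).

(** The polynomial N for which a2 p - (a3 p)' / 2 = N p / (4 a4), as soon as
    p' = p * logder L. *)
Definition bdpoly L : {poly R} :=
  4 *: (a4 L * a2 L) - 2 *: (a4 L * (a3 L)^`()) + 2 *: ((a4 L)^`() * a3 L)
  - a3 L ^+ 2.

Definition bdterm L p x : R := (bdpoly L).[x] * p x / (4 * (a4 L).[x]).

(** Convergence to 0 at the ends of the interval, in a form which does not
    distinguish finite from infinite ends. *)
Definition lower0 l r g : Prop := forall e, 0 < e ->
  exists2 y, itv_of l r y & forall x, itv_of l r x -> x < y -> `|g x| < e.

Definition upper0 l r g : Prop := forall e, 0 < e ->
  exists2 y, itv_of l r y & forall x, itv_of l r x -> y < x -> `|g x| < e.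

Definition ends0 l r g := lower0 l r g /\ upper0 l r g.

Definition is_weight L l r p : Prop := forall x, itv_of l r x ->
  0 < p x /\ is_derive x 1 p (p x * logder L x).

Definition moment_eq L : Prop :=
  2 *: (a4 L * (bdpoly L)^`()) + bdpoly L * (a3 L - 4 *: (a4 L)^`()) =
  8 *: (a4 L ^+ 2 * a1 L).

(** The same conditions as in selfadjoint_admissible, with every derivative of
    the weight eliminated: the second determining equation becomes the
    polynomial identity moment_eq, in which the weight no longer occurs. *)
Record reduced L l r p : Prop := Reduced {
  red_form : admissible_form L;
  red_itv : interval_for L l r;
  red_weight : is_weight L l r p;
  red_moment : moment_eq L;
  red_a4 : ends0 l r (fun x => (a4 L).[x] * p x);
  red_a3 : ends0 l r (fun x => (a3 L).[x] * p x);
  red_bd : ends0 l r (bdterm L p);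
  red_adm : admissible (itv_of l r) p }.

Lemma lower_end_cvg0 l r g : (l < r)%E ->
  (g x @[x --> lower_end l] --> (0 : R)) <-> lower0 l r g.
Proof.
move=> lr; case: l lr => [l| |] lr.
- rewrite /=; split.
  + move=> /cvgrPdist_lt cg e e0; have := cg e e0.
    rewrite /at_right /within /= => /nbhs_ballP[d /= d0 dg].
    have [y [ly]] : exists y, itv_of l%:E (Order.min r (l + d)%:E) y.
      by apply: itv_of_nonempty; rewrite lt_min lr lte_fin ltrDl.
    rewrite lt_min lte_fin => /andP[yr yld]; exists y => // x [lx _] xy.
    rewrite lte_fin in lx.
    have := dg x; rewrite sub0r normrN; apply => //.
    by rewrite /ball /= distrC ger0_norm ?subr_ge0 ?(ltW lx)//; lra.
  + move=> g0; apply/cvgrPdist_lt => e /g0[y [ly yr] yg].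
    near=> x; rewrite sub0r normrN; apply: yg; last first.
      by near: x; apply: nbhs_right_lt; rewrite -lte_fin.
    split; first by rewrite lte_fin; near: x; exact: nbhs_right_gt.
    apply: lt_trans yr; rewrite lte_fin.
    by near: x; apply: nbhs_right_lt; rewrite -lte_fin.
- by move: lr; rewrite ltNge leey.
- rewrite /=; split.
  + move=> /cvgrPdist_lt cg e e0; have := cg e e0.
    move=> [M [_ MP]].
    have [y [_]] : exists y, itv_of -oo%E (Order.min r M%:E) y.
      by apply: itv_of_nonempty; rewrite lt_min lr ltNyr.
    rewrite lt_min lte_fin => /andP[yr yM].
    exists y; first by split=> //; rewrite ltNyr.
    move=> x _ xy; have := MP x; rewrite sub0r normrN; apply.
    exact: lt_trans yM.
  + move=> g0; apply/cvgrPdist_lt => e /g0[y [_ yr] yg].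
    exists y; split; first exact: num_real.
    move=> x xy; rewrite sub0r normrN; apply: yg => //.
    by split; [rewrite ltNyr|apply: lt_trans yr; rewrite lte_fin].
Unshelve. all: by end_near. Qed.

Lemma upper_end_cvg0 l r g : (l < r)%E ->
  (g x @[x --> upper_end r] --> (0 : R)) <-> upper0 l r g.
Proof.
move=> lr; case: r lr => [r| |] lr.
- rewrite /=; split.
  + move=> /cvgrPdist_lt cg e e0; have := cg e e0.
    rewrite /at_left /within /= => /nbhs_ballP[d /= d0 dg].
    have [y []] : exists y, itv_of (Order.max l (r - d)%:E) r%:E y.
      by apply: itv_of_nonempty; rewrite gt_max lr lte_fin ltrBlDr ltrDl.
    rewrite gt_max lte_fin => /andP[ly yrd] yr; exists y => // x [_ xr] xy.
    rewrite lte_fin in xr.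
    have := dg x; rewrite sub0r normrN; apply => //.
    by rewrite /ball /= ger0_norm ?subr_ge0 ?(ltW xr)//; lra.
  + move=> g0; apply/cvgrPdist_lt => e /g0[y [ly yr] yg].
    near=> x; rewrite sub0r normrN; apply: yg; last first.
      by near: x; apply: nbhs_left_gt; rewrite -lte_fin.
    split; last by rewrite lte_fin; near: x; exact: nbhs_left_lt.
    apply: lt_trans ly _; rewrite lte_fin.
    by near: x; apply: nbhs_left_gt; rewrite -lte_fin.
- rewrite /=; split.
  + move=> /cvgrPdist_lt cg e e0; have := cg e e0.
    move=> [M [_ MP]].
    have [y []] : exists y, itv_of (Order.max l M%:E) +oo%E y.
      by apply: itv_of_nonempty; rewrite gt_max lr ltry.
    rewrite gt_max lte_fin => /andP[ly My] _.
    exists y; first by split=> //; rewrite ltry.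
    move=> x _ xy; have := MP x; rewrite sub0r normrN; apply.
    exact: lt_trans xy.
  + move=> g0; apply/cvgrPdist_lt => e /g0[y [ly _] yg].
    exists y; split; first exact: num_real.
    move=> x xy; rewrite sub0r normrN; apply: yg => //.
    by split; [apply: lt_trans ly _; rewrite lte_fin|rewrite ltry].
- by move: lr; rewrite ltNge leNye.
Unshelve. all: by end_near. Qed.

Lemma eq_ends0 l r f g : (forall x, itv_of l r x -> f x = g x) ->
  ends0 l r f -> ends0 l r g.
Proof.
move=> fg [f0 f1]; split=> e e0.
- by have [y Iy fy] := f0 e e0; exists y => // x Ix; rewrite -fg//; exact: fy.
- by have [y Iy fy] := f1 e e0; exists y => // x Ix; rewrite -fg//; exact: fy.
Qed.

Lemma sg_norm x : x != 0 -> Num.sg x = `|x| / x.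
Proof.
by move=> x0; apply: (mulIf x0); rewrite divfK// {2}[x]numEsg mulrA -expr2 sqr_sg x0 mul1r.
Qed.

(** Conversely, 2 ln (|a4| p) serves as the antiderivative of a3 / a4. *)
Lemma weight_ofP L l r p : (forall x, itv_of l r x -> ~~ root (a4 L) x) ->
  weight_of L (itv_of l r) p <-> is_weight L l r p.
Proof.
move=> rL; split.
- move=> [F [dF pE]] x Ix; have a0 : (a4 L).[x] != 0 := rL x Ix.
  split; first by rewrite pE// mulr_gt0 ?invr_gt0 ?normr_gt0 ?expR_gt0.
  apply: (is_derive_eq_on_itv Ix pE).
  have n0 : `|(a4 L).[x]| != 0 by rewrite normr_eq0.
  have dn := is_derive_inv (f := fun y => `|(a4 L).[y]|) n0 (is_derive_norm a0 (is_derive_horner (a4 L) x)).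
  have dE : is_derive x 1 (fun y => expR (F y / 2))
      (expR (F x / 2) * (2^-1 * ((a3 L).[x] / (a4 L).[x]))).
    apply: (is_derive1_comp (f := expR) (g := fun y => F y / 2)).
    under eq_fun do rewrite mulrC.
    exact: is_derive_cmul (dF x Ix).
  apply: (is_derive_eq (is_derive_mul dn dE)).
  rewrite pE// /logder.
  by rewrite sg_norm//; field; rewrite n0 a0.
- move=> wp; exists (fun y => 2 * ln (`|(a4 L).[y]| * p y)); split => x Ix.
  + have [p0 dp] := wp x Ix; have a0 : (a4 L).[x] != 0 := rL x Ix.
    have n0 : 0 < `|(a4 L).[x]| by rewrite normr_gt0.
    have dn := is_derive_mul (is_derive_norm a0 (is_derive_horner (a4 L) x)) dp.
    have np0 := mulr_gt0 n0 p0.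
    have dl := is_derive1_comp (g := fun y => `|(a4 L).[y]| * p y)
      (is_derive1_ln np0) dn.
    apply: is_derive_eq (is_derive_cmul 2 dl) _.
    rewrite /logder.
    by rewrite sg_norm//; field; rewrite a0 !gt_eqF.
  + have [p0 _] := wp x Ix; have a0 : (a4 L).[x] != 0 := rL x Ix.
    rewrite [2 * _]mulrC mulfK ?pnatr_eq0// lnK ?posrE ?mulr_gt0 ?normr_gt0//.
    by rewrite mulKf// normr_eq0.
Qed.


Lemma is_derive_poly_weight L l r p P x : is_weight L l r p -> itv_of l r x ->
  is_derive x 1 (fun y => P.[y] * p y) (p x * (P^`().[x] + P.[x] * logder L x)).
Proof.
move=> wp Ix; have [_ dp] := wp x Ix.
apply: (is_derive_eq (is_derive_mul (is_derive_horner P x) dp)).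
by ring.
Qed.

Lemma bdtermE L l r p x : (forall x, itv_of l r x -> ~~ root (a4 L) x) ->
  is_weight L l r p -> itv_of l r x ->
  (a2 L).[x] * p x - derive1 (fun y => (a3 L).[y] * p y) x / 2 = bdterm L p x.
Proof.
move=> rL wp Ix; have a0 : (a4 L).[x] != 0 := rL x Ix.
rewrite (derive1_is_derive (is_derive_poly_weight (a3 L) wp Ix)).
rewrite /bdterm /bdpoly /logder !hornerE /=; field; exact: a0.
Qed.

Lemma is_derive_bdterm L l r p x : (forall x, itv_of l r x -> ~~ root (a4 L) x) ->
  is_weight L l r p -> itv_of l r x ->
  is_derive x 1 (bdterm L p)
    (p x * (2 * ((a4 L).[x] * (bdpoly L)^`().[x])
            + (bdpoly L).[x] * ((a3 L).[x] - 4 * (a4 L)^`().[x]))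
     / (8 * (a4 L).[x] ^+ 2)).
Proof.
move=> rL wp Ix; have a0 : (a4 L).[x] != 0 := rL x Ix.
have d4 : is_derive x 1 (fun y => 4 * (a4 L).[y]) (4 * (a4 L)^`().[x]).
  exact: is_derive_cmul (is_derive_horner (a4 L) x).
have a40 : 4 * (a4 L).[x] != 0 by rewrite mulf_neq0.
have di := is_derive_inv (f := fun y => 4 * (a4 L).[y]) a40 d4.
apply: (is_derive_eq (is_derive_mul (is_derive_poly_weight (bdpoly L) wp Ix) di)).
by rewrite /logder; field; exact: a0.
Qed.

Lemma moment_eqP L l r : (l < r)%E ->
  moment_eq L <-> forall x, itv_of l r x ->
    2 * ((a4 L).[x] * (bdpoly L)^`().[x])
    + (bdpoly L).[x] * ((a3 L).[x] - 4 * (a4 L)^`().[x])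
    = 8 * ((a4 L).[x] ^+ 2 * (a1 L).[x]).
Proof.
rewrite /moment_eq; move: (bdpoly L) => N lr; split=> [me x _|me].
  have := congr1 (fun P => P.[x]) me; rewrite /= !hornerE /= => E.
  by apply: etrans (etrans _ E) _; ring.
apply: (poly_eq_on_itv lr) => x Ix; have := me x Ix; rewrite !hornerE /= => E.
by apply: etrans (etrans _ E) _; ring.
Qed.

(** The first equation is the logarithmic derivative of the weight; the second
    one states that the derivative of bdterm is a1 p. *)
Lemma determining_eqsP L l r p : (l < r)%E ->
  (forall x, itv_of l r x -> ~~ root (a4 L) x) -> is_weight L l r p ->
  determining_eqs L (itv_of l r) p <-> moment_eq L.
Proof.
move=> lr rL wp.
pose E x := 2 * ((a4 L).[x] * (bdpoly L)^`().[x])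
            + (bdpoly L).[x] * ((a3 L).[x] - 4 * (a4 L)^`().[x]).
have eq2 x : itv_of l r x ->
    derive1n 2 (fun y => (a3 L).[y] * p y) x
    - 2 * derive1 (fun y => (a2 L).[y] * p y) x + 2 * ((a1 L).[x] * p x)
    = 2 * p x * ((a1 L).[x] - E x / (8 * (a4 L).[x] ^+ 2)).
  move=> Ix; rewrite derive1nS derive1n1.
  have d2 := is_derive_poly_weight (a2 L) wp Ix.
  have dM := is_derive_bdterm rL wp Ix.
  have d3 y : itv_of l r y -> derive1 (fun y => (a3 L).[y] * p y) y =
      2 * ((a2 L).[y] * p y) + - (2 * bdterm L p y).
    by move=> Iy; rewrite -(bdtermE rL wp Iy); field.
  have d33 := is_derive_eq_on_itv Ix d3
    (is_derive_add (is_derive_cmul 2 d2) (is_derive_opp (is_derive_cmul 2 dM))).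
  rewrite (derive1_is_derive d33) (derive1_is_derive d2) -/(E x).
  by field; exact: rL x Ix.
split.
- move=> [_ h2]; apply/(moment_eqP _ lr) => x Ix.
  have [p0 _] := wp x Ix; have a0 : (a4 L).[x] != 0 := rL x Ix.
  have := h2 x Ix; rewrite eq2// => /eqP.
  rewrite !mulf_eq0 (gt_eqF p0) pnatr_eq0 /= subr_eq0 => /eqP aE.
  by rewrite aE -/(E x); field; exact: a0.
- move=> me; split=> x Ix; have a0 : (a4 L).[x] != 0 := rL x Ix.
    rewrite (derive1_is_derive (is_derive_poly_weight (a4 L) wp Ix)) /logder.
    by field; exact: a0.
  rewrite eq2//.
  rewrite /E (proj1 (moment_eqP L lr) me x Ix).
  by field; exact: a0.
Qed.

Lemma reducedP L l r p : selfadjoint_admissible L l r p <-> reduced L l r p.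
Proof.
split.
- case=> fL iL wp adm [de v0 v1].
  have [lr rL _ _] := iL; have {}wp := proj1 (weight_ofP p rL) wp.
  case: v0 v1 => q0 h0 b0 [q1 h1 b1]; split=> //.
  + exact: (proj1 (determining_eqsP lr rL wp) de).
  + by split; [apply/(lower_end_cvg0 _ lr)|apply/(upper_end_cvg0 _ lr)].
  + by split; [apply/(lower_end_cvg0 _ lr)|apply/(upper_end_cvg0 _ lr)].
  + apply: (eq_ends0 (fun x Ix => bdtermE rL wp Ix)).
    by split; [apply/(lower_end_cvg0 _ lr)|apply/(upper_end_cvg0 _ lr)].
- case=> fL iL wp me [q0 q1] [h0 h1] bd adm.
  have [lr rL _ _] := iL.
  have [b0 b1] := eq_ends0 (fun x Ix => esym (bdtermE rL wp Ix)) bd.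
  split=> //; first exact/weight_ofP.
  split; first exact: (proj2 (determining_eqsP lr rL wp) me).
  + by split; apply/(lower_end_cvg0 _ lr).
  + by split; apply/(upper_end_cvg0 _ lr).
Qed.

End Reduction.

(** * Lebesgue measure under an affine map *)

Section AffineMeasure.
Variable R : realType.
Local Notation mu := (@lebesgue_measure R).
Variables (alpha beta : R) (alpha0 : alpha != 0).
Let phi : measurableTypeR R -> measurableTypeR R := fun t => alpha * t + beta.

Let mphi : measurable_fun setT phi.
Proof.
apply: measurable_funD => //; apply: measurable_funM => //.
Qed.

(** Both sides are measures, and they agree on half-open intervals. *)
Lemma lebesgue_measure_affine (A : set R) : measurable A ->
  mu A = (`|alpha|%:E * mu (phi @^-1` A))%E.
Proof.
pose nu := mscale (NngNum (normr_ge0 alpha))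
  (measure_function_pushforward__canonical__measure_function_Measure mu mphi).
rewrite -[X in _ = X]/(nu A).
apply: lebesgue_measure_unique => //= _ [[a b]] _ <- /=.
rewrite /nu /mscale/= /pushforward/=.
have [a0|a0|/eqP] := ltrgt0P alpha; last by rewrite (negPf alpha0).
- rewrite (_ : phi @^-1` _ = `](a - beta) / alpha, (b - beta) / alpha]%classic).
    rewrite !lebesgue_measure_itv/= !lte_fin ltr_pM2r ?invr_gt0// ltrD2r.
    case: ltP => // _; last by rewrite mule0.
    rewrite -!EFinD -EFinM; congr EFin; field.
    by rewrite gt_eqF.
  apply/seteqP; split=> t /=; rewrite !in_itv/= /phi.
  + by rewrite ltr_pdivrMr// ler_pdivlMr// ltrBlDr lerBrDr [t * _]mulrC.
  + by rewrite ltr_pdivrMr// ler_pdivlMr// ltrBlDr lerBrDr [t * _]mulrC.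
- rewrite (_ : phi @^-1` _ = `[(b - beta) / alpha, (a - beta) / alpha[%classic).
    rewrite !lebesgue_measure_itv/= !lte_fin ltr_nM2r ?invr_lt0// ltrD2r.
    case: ltP => // _; last by rewrite mule0.
    rewrite -!EFinD -EFinM; congr EFin; field.
    by rewrite lt_eqF.
  apply/seteqP; split=> t /=; rewrite !in_itv/= /phi.
  + by rewrite ltr_ndivlMr// ler_ndivrMr// ltrBlDr lerBrDr [t * _]mulrC andbC.
  + by rewrite ltr_ndivlMr// ler_ndivrMr// ltrBlDr lerBrDr [t * _]mulrC andbC.
Qed.

Lemma ge0_integral_affine (D : set R) (f : R -> \bar R) : measurable D ->
  measurable_fun D f -> (forall y, D y -> (0 <= f y)%E) ->
  (\int[mu]_(x in D) f x
   = `|alpha|%:E * \int[mu]_(t in phi @^-1` D) f (alpha * t + beta)%R)%E.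
Proof.
move=> mD mf f0.
pose nu := measure_function_pushforward__canonical__measure_function_Measure mu mphi.
transitivity (\int[mscale (NngNum (normr_ge0 alpha)) nu]_(x in D) f x)%E.
  by apply: eq_measure_integral => A mA _; exact: lebesgue_measure_affine.
rewrite ge0_integral_mscale//; congr (_ * _)%E.
by rewrite ge0_integral_pushforward// => y /set_mem; exact: f0.
Qed.

End AffineMeasure.

(** * Operators under an affine change of variable *)

Section AffineChange.
Variable R : realType.
Implicit Types (l r : \bar R) (L M : diffop R) (p w : R -> R) (u v : {poly R}).
Implicit Types (alpha beta c k : R).

Lemma size_affX alpha beta : alpha != 0 -> size (affX alpha beta) = 2%N.
Proof.
move=> a0; rewrite /affX -mul_polyC size_MXaddC polyC_eq0 (negPf a0) /=.
by rewrite size_polyC a0.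
Qed.

Lemma horner_affX alpha beta u t :
  (u \Po affX alpha beta).[t] = u.[alpha * t + beta].
Proof. by rewrite horner_comp /affX !hornerE. Qed.

Lemma deriv_affX alpha beta u :
  (u \Po affX alpha beta)^`() = alpha *: (u^`() \Po affX alpha beta).
Proof.
by rewrite deriv_comp /affX !poly.derivE addr0 -scalerAr mulr1.
Qed.

Lemma derivn_affX alpha beta u n :
  (u \Po affX alpha beta)^`(n) = alpha ^+ n *: (u^`(n) \Po affX alpha beta).
Proof.
elim: n => [|n IH]; first by rewrite !derivn0 expr0 scale1r.
by rewrite !derivnS IH derivZ deriv_affX scalerA -exprSr.
Qed.

Lemma affX_inv alpha beta u : alpha != 0 ->
  (u \Po affX alpha^-1 (- beta / alpha)) \Po affX alpha beta = u.
Proof.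
move=> a0; apply: poly_ext => t; rewrite !horner_affX; congr horner.
by field.
Qed.

(** The monomials X, X^2, X^3 and X^4 successively isolate the coefficients. *)
Lemma diffop_app_eq0 M : (forall u, diffop_app M u = 0) ->
  [/\ a4 M = 0, a3 M = 0, a2 M = 0 & a1 M = 0].
Proof.
rewrite /diffop_app => M0.
have M1 n : a4 M * ('X^(n - 4) *+ n ^_ 4) + a3 M * ('X^(n - 3) *+ n ^_ 3)
    + a2 M * ('X^(n - 2) *+ n ^_ 2) + a1 M * ('X^(n - 1) *+ n ^_ 1) = 0.
  by have := M0 'X^n; rewrite -derivn1 !derivnXn.
have P0 (P : {poly R}) n : P * (1 *+ n.+1) = 0 -> P = 0.
  rewrite mulrnAr mulr1 -scaler_nat => /eqP.
  by rewrite scaler_eq0 pnatr_eq0 => /eqP.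
have e1 : a1 M = 0.
  by have := M1 1%N; rewrite (@ffact_small 1 4 isT) (@ffact_small 1 3 isT) (@ffact_small 1 2 isT) !mulr0n !mulr0 !add0r subnn => /P0.
have e2 : a2 M = 0.
  have := M1 2%N; rewrite (@ffact_small 2 4 isT) (@ffact_small 2 3 isT)
    e1 !mulr0n !mulr0 mul0r !add0r addr0.
  by rewrite subnn => /P0.
have e3 : a3 M = 0.
  have := M1 3%N; rewrite (@ffact_small 3 4 isT) e1 e2 !mulr0n !mulr0 !mul0r !add0r !addr0.
  by rewrite subnn => /P0.
have := M1 4%N; rewrite e1 e2 e3 !mul0r !addr0 subnn => /P0.
by [].
Qed.

(** Coefficientwise form of the statement that the change of variable
    x = alpha t + beta turns L into c M (see same_coefsP); the powers of alpha
    come from the chain rule. *)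
Definition same_coefs alpha beta c L M : Prop :=
  [/\ a4 L \Po affX alpha beta = (c * alpha ^+ 4) *: a4 M,
      a3 L \Po affX alpha beta = (c * alpha ^+ 3) *: a3 M,
      a2 L \Po affX alpha beta = (c * alpha ^+ 2) *: a2 M &
      a1 L \Po affX alpha beta = (c * alpha) *: a1 M].

Lemma same_coefsP alpha beta c L M : alpha != 0 ->
  same_coefs alpha beta c L M <->
  forall u, diffop_app L u \Po affX alpha beta
            = c *: diffop_app M (u \Po affX alpha beta).
Proof.
move=> a0; rewrite /diffop_app; split.
- case=> e4 e3 e2 e1 u; rewrite -!derivn1 !derivn_affX.
  rewrite !comp_polyD !comp_polyM e4 e3 e2 e1.
  by apply: poly_ext => t; rewrite !hornerE /=; ring.
- move=> h.
  pose D := DiffOp (a4 L \Po affX alpha beta - (c * alpha ^+ 4) *: a4 M)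
    (alpha *: (a3 L \Po affX alpha beta - (c * alpha ^+ 3) *: a3 M))
    (alpha ^+ 2 *: (a2 L \Po affX alpha beta - (c * alpha ^+ 2) *: a2 M))
    (alpha ^+ 3 *: (a1 L \Po affX alpha beta - (c * alpha) *: a1 M)).
  have D0 v : diffop_app D v = 0.
    have := h (v \Po affX alpha^-1 (- beta / alpha)).
    set u := v \Po _.
    have uv n : v^`(n) = alpha ^+ n *: (u^`(n) \Po affX alpha beta).
      by rewrite -derivn_affX /u affX_inv.
    clearbody u.
    rewrite /diffop_app -!derivn1 !derivn_affX !uv !comp_polyD !comp_polyM /D /=.
    move: (u^`(4) \Po _) (u^`(3) \Po _) (u^`(2) \Po _) (u^`(1) \Po _).
    move=> u4 u3 u2 u1 /(congr1 (fun P => alpha ^+ 4 *: P))/= e.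
    apply/eqP; rewrite -(subrr (alpha ^+ 4 *: (c *: (a4 M * (alpha ^+ 4 *: u4)
      + a3 M * (alpha ^+ 3 *: u3) + a2 M * (alpha ^+ 2 *: u2) + a1 M * (alpha ^+ 1 *: u1))))).
    rewrite -[X in _ == X - _]e; apply/eqP/poly_ext => t.
    by rewrite !hornerE /=; ring.
  have [] := diffop_app_eq0 D0; rewrite /D /=.
  move=> /eqP; rewrite subr_eq0 => /eqP e4.
  move=> /eqP; rewrite scaler_eq0 (negPf a0) subr_eq0 => /eqP e3.
  move=> /eqP; rewrite scaler_eq0 expf_eq0 (negPf a0) andbF subr_eq0 => /eqP e2.
  by move=> /eqP; rewrite scaler_eq0 expf_eq0 (negPf a0) andbF subr_eq0 => /eqP e1.
Qed.

Lemma same_coefs_horner alpha beta c L M : same_coefs alpha beta c L M ->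
  forall t, [/\ (a4 L).[alpha * t + beta] = c * alpha ^+ 4 * (a4 M).[t],
      (a3 L).[alpha * t + beta] = c * alpha ^+ 3 * (a3 M).[t],
      (a2 L).[alpha * t + beta] = c * alpha ^+ 2 * (a2 M).[t] &
      (a1 L).[alpha * t + beta] = c * alpha * (a1 M).[t]].
Proof.
case=> e4 e3 e2 e1 t; rewrite -!horner_affX e4 e3 e2 e1.
by rewrite !hornerZ.
Qed.

Lemma same_coefs_deriv alpha beta c L M : alpha != 0 ->
  same_coefs alpha beta c L M ->
  forall t, (a4 L)^`().[alpha * t + beta] = c * alpha ^+ 3 * (a4 M)^`().[t] /\
    (a3 L)^`().[alpha * t + beta] = c * alpha ^+ 2 * (a3 M)^`().[t].
Proof.
move=> a0 [e4 e3 _ _] t; rewrite -!horner_affX; split; apply: (mulfI a0);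
  rewrite -hornerZ -deriv_affX ?e4 ?e3 derivZ hornerZ; ring.
Qed.

Lemma bdpoly_affine alpha beta c L M : alpha != 0 ->
  same_coefs alpha beta c L M ->
  bdpoly L \Po affX alpha beta = (c ^+ 2 * alpha ^+ 6) *: bdpoly M.
Proof.
move=> a0 e; apply: poly_ext => t; rewrite horner_affX /bdpoly !hornerE /=.
have [-> -> -> _] := same_coefs_horner e t.
have [-> ->] := same_coefs_deriv a0 e t.
by ring.
Qed.

End AffineChange.

(** * Affine invariance of the whole problem *)

Section AffineInvariance.
Variable R : realType.
Implicit Types (l r : \bar R) (L M : diffop R) (p w g : R -> R).

(** The finite endpoints are the boundary points of the interval; stated in
    this way, they are visibly carried along by an affine map. *)
Lemma finite_endP l r x : (l < r)%E ->
  (l = x%:E \/ r = x%:E) <->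
  ~ itv_of l r x /\ forall e, 0 < e -> exists2 y, itv_of l r y & `|x - y| < e.
Proof.
move=> lr; split.
- case=> E.
  + subst l; split; first by case; rewrite ltxx.
    move=> e e0; have [y [xy]] : exists y, itv_of x%:E (Order.min r (x + e)%:E) y.
      by apply: itv_of_nonempty; rewrite lt_min lr lte_fin ltrDl.
    rewrite lt_min lte_fin => /andP[yr ye]; exists y => //.
    by move: xy; rewrite lte_fin => xy; rewrite ltr0_norm; lra.
  + subst r; split; first by case; rewrite ltxx.
    move=> e e0; have [y []] : exists y, itv_of (Order.max l (x - e)%:E) x%:E y.
      by apply: itv_of_nonempty; rewrite gt_max lr lte_fin ltrBlDr ltrDl.
    rewrite gt_max lte_fin => /andP[ly ye] yx; exists y => //.
    by move: yx; rewrite lte_fin => yx; rewrite gtr0_norm; lra.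
- move=> [nI bI]; have [xl|lx] := leP x%:E l.
  + left; apply/eqP; rewrite eq_le xl andbT; apply/negPn/negP; rewrite -ltNge => xl'.
    have [z [xz zl]] := itv_of_nonempty xl'.
    have [|y [ly _]] := bI (z - x); first by rewrite subr_gt0 -lte_fin.
    have := lt_trans zl ly; rewrite lte_fin => zy.
    by move: xz; rewrite lte_fin => xz; rewrite ltr0_norm; lra.
  + right; have [rx|xr] := leP r x%:E; last by case: nI.
    apply/eqP; rewrite eq_le rx /=; apply/negPn/negP; rewrite -ltNge => rx'.
    have [z [rz zx]] := itv_of_nonempty rx'.
    have [|y [_ yr]] := bI (x - z); first by rewrite subr_gt0 -lte_fin.
    have := lt_trans yr rz; rewrite lte_fin => yz.
    by move: zx; rewrite lte_fin => zx; rewrite gtr0_norm; lra.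
Qed.

Section Transport.
Variables (alpha beta c k : R) (L M : diffop R) (l r l' r' : \bar R).
Variables (p w : R -> R).
Hypotheses (alpha0 : alpha != 0) (c0 : c != 0) (k0 : 0 < k).
Hypothesis coefs : same_coefs alpha beta c L M.
Hypothesis itvE : forall t, itv_of l' r' t <-> itv_of l r (alpha * t + beta).
Hypothesis pw : forall t, itv_of l' r' t -> p (alpha * t + beta) = k * w t.

Let inv x := alpha^-1 * x + (- beta / alpha).

Let invK x : alpha * inv x + beta = x.
Proof. by rewrite /inv; field. Qed.

Let inv_itv x : itv_of l r x -> itv_of l' r' (inv x).
Proof. by move=> Ix; apply/itvE; rewrite invK. Qed.

Lemma ends0_affine g : ends0 l' r' (fun t => g (alpha * t + beta)) -> ends0 l r g.
Proof.
move=> [g0 g1]; have [a0|a0|/eqP] := ltrgt0P alpha; last by rewrite (negPf alpha0).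
- split=> e e0.
  + have [y Iy ge] := g0 e e0; exists (alpha * y + beta); first exact/itvE.
    move=> x Ix xy; rewrite -[x]invK; apply: ge; first exact: inv_itv.
    by move: xy; rewrite -{1}[x]invK ltrD2r ltr_pM2l.
  + have [y Iy ge] := g1 e e0; exists (alpha * y + beta); first exact/itvE.
    move=> x Ix xy; rewrite -[x]invK; apply: ge; first exact: inv_itv.
    by move: xy; rewrite -{1}[x]invK ltrD2r ltr_pM2l.
- split=> e e0.
  + have [y Iy ge] := g1 e e0; exists (alpha * y + beta); first exact/itvE.
    move=> x Ix xy; rewrite -[x]invK; apply: ge; first exact: inv_itv.
    by move: xy; rewrite -{1}[x]invK ltrD2r ltr_nM2l.
  + have [y Iy ge] := g0 e e0; exists (alpha * y + beta); first exact/itvE.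
    move=> x Ix xy; rewrite -[x]invK; apply: ge; first exact: inv_itv.
    by move: xy; rewrite -{1}[x]invK ltrD2r ltr_nM2l.
Qed.

Lemma ends0_cmul d f g : (forall t, itv_of l' r' t -> f t = d * g t) ->
  ends0 l' r' g -> ends0 l' r' f.
Proof.
move=> fg [g0 g1]; have d0 : 0 < `|d| + 1 by rewrite ltr_wpDl.
have key e x : 0 < e -> itv_of l' r' x -> `|g x| < e / (`|d| + 1) -> `|f x| < e.
  move=> e0 Ix; rewrite fg// normrM ltr_pdivlMr// => h.
  apply: le_lt_trans h; rewrite mulrDr mulr1 mulrC lerDl//.
split=> e e0.
- have [|y Iy ge] := g0 (e / (`|d| + 1)); first by rewrite divr_gt0.
  by exists y => // x Ix xy; apply: key => //; exact: ge.
- have [|y Iy ge] := g1 (e / (`|d| + 1)); first by rewrite divr_gt0.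
  by exists y => // x Ix xy; apply: key => //; exact: ge.
Qed.

Hypothesis redM : reduced M l' r' w.

Lemma lt_ends_affine : (l < r)%E.
Proof.
have [lr' _ _ _] := red_itv redM.
have [t /itvE[h1 h2]] := itv_of_nonempty lr'; exact: lt_trans h1 h2.
Qed.

Lemma admissible_form_affine : admissible_form L.
Proof.
have [s4 s3 s2 s1 n4] := red_form redM.
have [e4 e3 e2 e1] := coefs.
have sz (P Q : {poly R}) d n : P \Po affX alpha beta = d *: Q ->
    (size Q <= n)%N -> (size P <= n)%N.
  move=> e sQ; rewrite -(size_comp_poly2 P (size_affX beta alpha0)) e.
  exact: leq_trans (size_scale_leq _ _) sQ.
split; [exact: sz e4 s4|exact: sz e3 s3|exact: sz e2 s2|exact: sz e1 s1|].
apply/eqP => L0; move/eqP: e4; rewrite L0 comp_poly0 eq_sym scaler_eq0.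
by rewrite (negPf n4) mulf_eq0 expf_eq0 (negPf c0) (negPf alpha0).
Qed.

Lemma root_affine t : root (a4 L) (alpha * t + beta) = root (a4 M) t.
Proof.
have [e4 _ _ _] := same_coefs_horner coefs t.
by rewrite /root e4 mulf_eq0 mulf_eq0 expf_eq0 (negPf c0) (negPf alpha0).
Qed.

Lemma interval_for_affine : interval_for L l r.
Proof.
have [lr' rM lM rrM] := red_itv redM; have lr := lt_ends_affine.
have ends x : (l = x%:E \/ r = x%:E) -> root (a4 L) x.
  move=> /(finite_endP x lr)[nI bI]; rewrite -[x]invK root_affine.
  suff : l' = (inv x)%:E \/ r' = (inv x)%:E by case; [exact: lM|exact: rrM].
  apply/(finite_endP _ lr'); split; first by move/itvE; rewrite invK.
  move=> e e0; have [|y Iy xy] := bI (e * `|alpha|).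
    by rewrite mulr_gt0 ?normr_gt0.
  exists (inv y); first exact: inv_itv.
  have -> : inv x - inv y = (x - y) / alpha by rewrite /inv; field.
  by rewrite normrM normfV ltr_pdivrMr ?normr_gt0.
split=> //.
- by move=> x Ix; rewrite -[x]invK root_affine; apply: rM; exact: inv_itv.
- by move=> x lx; apply: ends; left.
- by move=> x rx; apply: ends; right.
Qed.

Lemma is_weight_affine : is_weight L l r p.
Proof.
move=> x Ix; have It := inv_itv Ix; have [w0 dw] := red_weight redM It.
have pE y : itv_of l r y -> p y = k * w (inv y).
  by move=> Iy; rewrite -pw ?invK//; exact: inv_itv.
split; first by rewrite pE// mulr_gt0.
have dI : is_derive x 1 (fun y => w (inv y)) (alpha^-1 * (w (inv x) * logder M (inv x))).
  exact: is_derive_affine.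
apply: (is_derive_eq_on_itv Ix pE).
apply: (is_derive_eq (is_derive_cmul k dI)).
suff -> : logder L x = alpha^-1 * logder M (inv x) by rewrite pE//; ring.
have [_ rM _ _] := red_itv redM.
have a40 : (a4 M).[inv x] != 0 := rM _ It.
have [e4 e3 _ _] := same_coefs_horner coefs (inv x).
have [d4 _] := same_coefs_deriv alpha0 coefs (inv x).
rewrite invK in e4 e3 d4; rewrite /logder e4 e3 d4.
by field; rewrite a40 c0 alpha0.
Qed.

Lemma moment_eq_affine : moment_eq L.
Proof.
have lr' : (l' < r')%E by have [] := red_itv redM.
have me := proj1 (moment_eqP M lr') (red_moment redM).
apply/(moment_eqP L lt_ends_affine) => x Ix; have It := inv_itv Ix.
have [e4 e3 _ e1] := same_coefs_horner coefs (inv x).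
have [d4 _] := same_coefs_deriv alpha0 coefs (inv x).
have bE := bdpoly_affine alpha0 coefs.
have N0 : (bdpoly L).[alpha * inv x + beta] = c ^+ 2 * alpha ^+ 6 * (bdpoly M).[inv x].
  by rewrite -horner_affX bE hornerZ.
have N1 : (bdpoly L)^`().[alpha * inv x + beta]
    = c ^+ 2 * alpha ^+ 5 * (bdpoly M)^`().[inv x].
  apply: (mulfI alpha0).
  by rewrite -horner_affX -hornerZ -deriv_affX bE derivZ hornerZ; ring.
rewrite invK in e4 e3 e1 d4 N0 N1; rewrite e4 e3 e1 d4 N0 N1.
have {}me := me _ It.
transitivity (c ^+ 3 * alpha ^+ 9 * (8 * ((a4 M).[inv x] ^+ 2 * (a1 M).[inv x]))).
  by rewrite -me; ring.
by ring.
Qed.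

Lemma admissible_affine : admissible (itv_of l r) p.
Proof.
move=> u; have mI : measurable (itv_of l r).
  by apply: open_measurable; exact: itv_of_open.
rewrite (@ge0_integral_affine R alpha beta alpha0)//; last 2 first.
- apply/measurable_EFinP; apply: measurable_funM; last first.
    apply: measurableT_comp => //; apply: measurable_funTS.
    by apply: continuous_measurable_fun; exact: continuous_horner.
  apply: open_continuous_measurable_fun; first exact: itv_of_open.
  move=> x /set_mem Ix; have [_ dp] := is_weight_affine Ix.
  exact: is_derive_continuous dp.
- by move=> y Iy; have [p0 _] := is_weight_affine Iy; rewrite lee_fin mulr_ge0 ?(ltW p0).
rewrite (_ : _ @^-1` _ = itv_of l' r'); last first.
  by apply/seteqP; split=> t; [move=> It; exact/itvE|move/itvE].
pose v := k *: (u \Po affX alpha beta).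
rewrite (_ : (\int[_]_(t in _) _ = \int[@lebesgue_measure R]_(t in itv_of l' r') (w t * `|v.[t]|)%:E)%E).
  by apply: lte_mul_pinfty => //; exact: red_adm redM v.
apply: eq_integral => t /set_mem It; rewrite pw// /v hornerZ horner_affX.
by rewrite normrM (gtr0_norm k0); congr EFin; ring.
Qed.

(** Every condition is homogeneous: the change of variable multiplies the
    weight and the three boundary functions by constants, the two sides of the
    moment equation by c ^ 3 alpha ^ 9, and the integrals by |alpha|. *)
Lemma reduced_affine : reduced L l r p.
Proof.
split.
- exact: admissible_form_affine.
- exact: interval_for_affine.
- exact: is_weight_affine.
- exact: moment_eq_affine.
- apply: ends0_affine.
  apply: (ends0_cmul (d := c * alpha ^+ 4 * k)) (red_a4 redM) => t It /=.
  by rewrite pw//; have [-> _ _ _] := same_coefs_horner coefs t; ring.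
- apply: ends0_affine.
  apply: (ends0_cmul (d := c * alpha ^+ 3 * k)) (red_a3 redM) => t It /=.
  by rewrite pw//; have [_ -> _ _] := same_coefs_horner coefs t; ring.
- apply: ends0_affine.
  apply: (ends0_cmul (d := c * alpha ^+ 2 * k)) (red_bd redM) => t It.
  have [_ rM _ _] := red_itv redM; have a40 : (a4 M).[t] != 0 := rM _ It.
  rewrite /bdterm pw// -horner_affX (bdpoly_affine alpha0 coefs) hornerZ.
  have [-> _ _ _] := same_coefs_horner coefs t.
  by field; rewrite a40 c0 alpha0.
- exact: admissible_affine.
Qed.

End Transport.
End AffineInvariance.

(** * Local behaviour at a finite endpoint *)

Section FiniteEndpoint.
Variable R : realType.
Implicit Types (r : \bar R) (x y : R) (L : diffop R) (p f g v : R -> R).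
Implicit Types (P Q n d : {poly R}).

Lemma factor_root P x : P.[x] = 0 -> exists Q, P = Q * ('X - x%:P).
Proof. by move=> /rootP/factor_theorem. Qed.

Lemma continuous_quotient n d x : d.[x] != 0 ->
  {for x, continuous (fun y => n.[y] / d.[y])}.
Proof.
move=> d0; have di := is_derive_inv (f := horner d) d0 (is_derive_horner d x).
exact: is_derive_continuous (is_derive_mul (is_derive_horner n x) di).
Qed.

Lemma right_nbhs_lt f x r K : (x%:E < r)%E -> {for x, continuous f} -> f x < K ->
  exists2 y, itv_of x%:E r y & forall z, x <= z <= y -> f z < K.
Proof.
move=> xr cf fK.
have /nbhs_ballP[e /= e0 eK] : \forall z \near x, f z < K by apply: (cvgr_lt _ cf).
have [y [xy]] : exists y, itv_of x%:E (Order.min r (x + e)%:E) y.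
  by apply: itv_of_nonempty; rewrite lt_min xr lte_fin ltrDl.
rewrite lt_min lte_fin => /andP[yr ye]; exists y => // z /andP[xz zy].
apply: eK; rewrite /ball /= distrC ger0_norm ?subr_ge0//; lra.
Qed.

(** If n / d is nonpositive at x, then n / (d (y - x)) is bounded above for
    y close to x on the right: the only pole is that of the value at x, and
    it has the good sign. *)
Lemma simple_pole_le n d x r : (x%:E < r)%E -> d.[x] != 0 -> n.[x] / d.[x] <= 0 ->
  exists K, exists2 y, itv_of x%:E r y &
    forall z, x < z <= y -> n.[z] / (d.[z] * (z - x)) <= K.
Proof.
move=> xr d0 nd.
have [Q QE] : exists Q, d.[x] *: n - n.[x] *: d = Q * ('X - x%:P).
  by apply: factor_root; rewrite !hornerE /=; ring.
have cd : {for x, continuous (fun y => Q.[y] / (d.[x] *: d).[y])}.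
  by apply: continuous_quotient; rewrite hornerZ mulf_neq0.
have [y1 I1 h1] := right_nbhs_lt xr cd (ltr_pwDr ltr01 (lexx _)).
have d2 : 0 < d.[x] ^+ 2 by rewrite exprn_even_gt0.
have cd2 : {for x, continuous (fun y => (- (d.[x] *: d)).[y])}.
  exact: continuous_horner.
have [|y2 I2 h2] := right_nbhs_lt (K := 0) xr cd2.
  by rewrite hornerN hornerZ oppr_lt0 -expr2.
exists (Q.[x] / (d.[x] *: d).[x] + 1); exists (Order.min y1 y2).
  by case: I1 I2 => [? ?] [? ?]; split; rewrite ?EFin_min ?lt_min ?gt_min; apply/andP || apply/orP; auto.
move=> z; rewrite le_min => /andP[xz /andP[zy1 zy2]].
have := h2 z; rewrite (ltW xz) zy2 hornerN oppr_lt0 => /(_ isT) dz.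
have zx : 0 < z - x by rewrite subr_gt0.
have dz0 : d.[z] != 0.
  by apply/eqP => dz1; move: dz; rewrite hornerZ dz1 mulr0 ltxx.
have := h1 z; rewrite (ltW xz) zy1 => /(_ isT)/ltW; apply: le_trans.
have := congr1 (fun P => P.[z]) QE; rewrite /= !hornerE /= => QzE.
have -> : n.[z] / (d.[z] * (z - x)) = Q.[z] / (d.[x] * d.[z]) + n.[x] / d.[x] / (z - x).
  have -> : Q.[z] = (d.[x] * n.[z] - n.[x] * d.[z]) / (z - x).
    by rewrite QzE mulfK// gt_eqF.
  by field; rewrite dz0 d0 gt_eqF.
by rewrite gerDl; apply: mulr_le0_ge0 => //; rewrite invr_ge0 ltW.
Qed.

(** Multiplying by an exponential absorbs the bound K on the logarithmic
    derivative. *)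
Lemma lower_bound_logderivative x y r v rho K : itv_of x%:E r y ->
  (forall z, itv_of x%:E r z -> 0 < v z /\ is_derive z 1 v (v z * rho z)) ->
  (forall z, x < z <= y -> rho z <= K) ->
  exists2 e, 0 < e & forall z, x < z <= y -> e <= v z.
Proof.
move=> Iy v' rhoK; have [xy yr] := Iy; rewrite lte_fin in xy.
have [vy _] := v' y Iy.
exists (v y * expR (- `|K| * (y - x))); first by rewrite mulr_gt0 ?expR_gt0.
move=> z /andP[xz zy].
have Iz u : x < u <= y -> itv_of x%:E r u.
  by move=> /andP[xu uy]; split; [rewrite lte_fin|apply: le_lt_trans yr; rewrite lee_fin].
have dE (u : R) : is_derive u 1 (fun t => expR (- K * t)) (expR (- K * u) * - K).
  have h : is_derive u 1 (fun t : R => - K * t) (- K * 1) by apply: is_derive_cmul.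
  rewrite mulr1 in h.
  exact: (is_derive1_comp (f := expR) (g := fun t => - K * t)).
have le1 : - (v z * expR (- K * z)) <= - (v y * expR (- K * y)).
  apply: (@derivative_ge0_homo _ (fun t => - (v t * expR (- K * t)))
    (fun u => - (v u * rho u * expR (- K * u) + v u * (expR (- K * u) * - K)))) => //.
  - move=> u /andP[zu uy]; have Iu : x < u <= y by rewrite uy (lt_le_trans xz zu).
    have [_ dv] := v' u (Iz u Iu).
    exact: is_derive_opp (is_derive_mul dv (dE u)).
  - move=> u /andP[zu uy]; have Iu : x < u <= y by rewrite uy (lt_le_trans xz zu).
    have [vu _] := v' u (Iz u Iu).
    have -> : - (v u * rho u * expR (- K * u) + v u * (expR (- K * u) * - K))
        = v u * expR (- K * u) * (K - rho u) by ring.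
    by rewrite mulr_ge0 ?subr_ge0 ?rhoK// mulr_ge0 ?expR_ge0// ltW.
rewrite lerN2 in le1.
have -> : v z = v z * expR (- K * z) * expR (K * z).
  by rewrite -mulrA -expRD mulNr addNr expR0 mulr1.
apply: le_trans (_ : v y * expR (- K * y) * expR (K * z) <= _).
  rewrite -mulrA ler_wpM2l ?(ltW vy)// -expRD ler_expR.
  have : `|K| * (y - z) <= `|K| * (y - x) by rewrite ler_wpM2l//; lra.
  have := ler_norm K; have : 0 <= y - z by lra.
  move=> yz0 KK; have : K * (y - z) <= `|K| * (y - z) by rewrite ler_wpM2r.
  by lra.
by rewrite ler_wpM2r ?expR_ge0.
Qed.

(** The analytic heart of the classification at a finite endpoint x: a
    positive function v whose logarithmic derivative n / (d (y - x)) has a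
    nonpositive residue at x cannot tend to zero there, and neither can its
    product with a rational function regular and nonzero at x. *)
Lemma not_lower0 x r v f n d n' d' : (x%:E < r)%E ->
  (forall z, itv_of x%:E r z -> 0 < v z /\
     is_derive z 1 v (v z * (n.[z] / (d.[z] * (z - x))))) ->
  d.[x] != 0 -> n.[x] / d.[x] <= 0 ->
  (forall z, itv_of x%:E r z -> f z = n'.[z] / d'.[z] * v z) ->
  d'.[x] != 0 -> n'.[x] != 0 -> ~ lower0 x%:E r f.
Proof.
move=> xr v' d0 nd fE d'0 n'0 f0.
have [K [y Iy yK]] := simple_pole_le xr d0 nd.
have [e e0 ev] := lower_bound_logderivative Iy v' yK.
pose s := `|n'.[x] / d'.[x]|.
have s0 : 0 < s by rewrite normr_gt0 mulf_neq0 ?invr_eq0.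
have cs : {for x, continuous (fun y => - `|n'.[y] / d'.[y]|)}.
  apply: continuousN; apply: continuous_comp; last exact: norm_continuous.
  exact: continuous_quotient.
have [|y1 I1 h1] := right_nbhs_lt (K := - (s / 2)) xr cs.
  by rewrite -/s; lra.
have [y2 I2 h2] := f0 (s / 2 * e) ltac:(by rewrite mulr_gt0// divr_gt0).
have [z [xz]] : exists z, itv_of x%:E (Order.min y%:E (Order.min y1%:E y2%:E)) z.
  by apply: itv_of_nonempty; rewrite !lt_min; case: Iy => -> _; case: I1 => -> _; case: I2 => -> _.
rewrite !lt_min !lte_fin => /and3P[zy zy1 zy2]; rewrite lte_fin in xz.
have Iz : itv_of x%:E r z.
  by case: Iy => _ yr; split; [rewrite lte_fin|apply: lt_trans yr; rewrite lte_fin].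
have := h2 z Iz zy2; rewrite fE// normrM.
have [v0 _] := v' z Iz; rewrite (gtr0_norm v0).
have := h1 z; rewrite (ltW xz) (ltW zy1) ltrN2 => /(_ isT) sz.
have := ev z; rewrite xz (ltW zy) => /(_ isT) ez.
apply/negP; rewrite -leNgt; apply: ler_pM => //; [|exact: ltW|exact: ltW].
by rewrite divr_ge0 ?(ltW s0).
Qed.

End FiniteEndpoint.

(** * Multiplicities at a finite endpoint *)

Section EndpointMultiplicities.
Variable R : realType.
Variables (L : diffop R) (x : R) (r : \bar R) (p : R -> R).
Hypothesis redL : reduced L x%:E r p.

Lemma moment_eq_horner (M : diffop R) (y : R) : moment_eq M ->
  2 * ((a4 M).[y] * (bdpoly M)^`().[y])
  + (bdpoly M).[y] * ((a3 M).[y] - 4 * (a4 M)^`().[y])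
  = 8 * ((a4 M).[y] ^+ 2 * (a1 M).[y]).
Proof.
move=> me; have oo : ((-oo : \bar R) < +oo)%E by [].
apply: (proj1 (moment_eqP M oo) me).
by split; [rewrite ltNyr|rewrite ltry].
Qed.

Lemma bdpoly_horner (M : diffop R) (y : R) : (bdpoly M).[y] =
  4 * ((a4 M).[y] * (a2 M).[y]) - 2 * ((a4 M).[y] * (a3 M)^`().[y])
  + 2 * ((a4 M)^`().[y] * (a3 M).[y]) - (a3 M).[y] ^+ 2.
Proof. by rewrite /bdpoly !hornerE /=; ring. Qed.

Let xr : (x%:E < r)%E. Proof. by have [] := red_itv redL. Qed.

Let wx z : itv_of x%:E r z -> 0 < z - x.
Proof. by case; rewrite lte_fin subr_gt0. Qed.

Let a40 z : itv_of x%:E r z -> (a4 L).[z] != 0.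
Proof. by have [_ rL _ _] := red_itv redL; exact: rL. Qed.

Let d1 (z : R) : is_derive z 1 (fun t => t - x) (1 : R).
Proof.
have h : is_derive z 1 (fun t => t + - x) ((1 : R) + 0) by apply: is_derive_add.
by rewrite addr0 in h.
Qed.

(** At a simple zero of a4 the moment equation leaves three local exponents
    for p, namely p ~ (z - x)^m with m = -1, 0 or 1; they contradict in turn
    the vanishing of a4 p, of a3 p and of a2 p - (a3 p)' / 2. *)
Lemma lower_end_zeros : [/\ (a4 L).[x] = 0, (a4 L)^`().[x] = 0 & (a3 L).[x] = 0].
Proof.
have ax0 : (a4 L).[x] = 0 by apply/rootP; have [_ _ h _] := red_itv redL; exact: h.
have := moment_eq_horner x (red_moment redL).
have NE : (bdpoly L).[x] = 2 * ((a4 L)^`().[x] * (a3 L).[x]) - (a3 L).[x] ^+ 2.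
  by rewrite bdpoly_horner ax0; ring.
rewrite ax0 expr0n /= !mul0r !mulr0 add0r => E.
have [d0|d0] := eqVneq ((a4 L)^`().[x]) 0.
  split=> //; move: E; rewrite NE d0 !mul0r !mulr0 add0r subr0 mulNr.
  by move/eqP; rewrite oppr_eq0 !mulf_eq0 !orbb => /eqP.
have [Q QE] := factor_root ax0.
have aE z : (a4 L).[z] = Q.[z] * (z - x) by rewrite QE !hornerE.
have Q0 : Q.[x] = (a4 L)^`().[x].
  by rewrite QE !poly.derivE !hornerE /= subrr mulr0 add0r.
have Qx : Q.[x] != 0 by rewrite Q0.
have Qz z : itv_of x%:E r z -> Q.[z] != 0.
  by move=> /a40; rewrite aE mulf_eq0 negb_or => /andP[].
have dQ0 : (2 *: Q).[x] != 0 by rewrite hornerZ mulf_neq0.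
exfalso; move: E; rewrite NE => /eqP.
have -> : 2 * ((a4 L)^`().[x] * (a3 L).[x]) - (a3 L).[x] ^+ 2 =
  (a3 L).[x] * (2 * Q.[x] - (a3 L).[x]) by rewrite Q0; ring.
(* In each case, the power of z - x that multiplies p cancels the pole of its
   logarithmic derivative. *)
rewrite -Q0 -mulrA !mulf_eq0 !subr_eq0 => /or3P[/eqP h0|/eqP h0|/eqP h0].
- apply: (@not_lower0 _ x r (fun z => (z - x) * p z) (fun z => (a4 L).[z] * p z)
    (a3 L - 2 *: (a4 L)^`() + 2 *: Q) (2 *: Q) Q 1 xr) => //.
  + move=> z Iz; have [pz dp] := red_weight redL Iz; have zx := wx Iz.
    split; first by rewrite mulr_gt0.
    apply: (is_derive_eq (is_derive_mul (d1 z) dp)).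
    rewrite /logder aE !hornerE /=; field.
    by rewrite gt_eqF//= Qz.
  + by rewrite !hornerE /= h0 -Q0 sub0r addNr mul0r.
  + by move=> z Iz; rewrite aE !hornerE /=; field.
  + by rewrite !hornerE oner_neq0.
  + by have [] := red_a4 redL.
- apply: (@not_lower0 _ x r p (fun z => (a3 L).[z] * p z)
    (a3 L - 2 *: (a4 L)^`()) (2 *: Q) (a3 L) 1 xr) => //.
  + move=> z Iz; have [pz dp] := red_weight redL Iz; have zx := wx Iz.
    split => //; apply: (is_derive_eq dp).
    rewrite /logder aE !hornerE /=; field.
    by rewrite gt_eqF//= Qz.
  + by rewrite !hornerE /= -h0 -Q0 subrr mul0r.
  + by move=> z Iz; rewrite !hornerE /=; field.
  + by rewrite !hornerE oner_neq0.
  + by rewrite -h0 mulf_neq0.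
  + by have [] := red_a3 redL.
- apply: (@not_lower0 _ x r (fun z => p z * (z - x)^-1) (bdterm L p)
    (a3 L - 2 *: (a4 L)^`() - 2 *: Q) (2 *: Q) (bdpoly L) (4 *: Q) xr) => //.
  + move=> z Iz; have [pz dp] := red_weight redL Iz; have zx := wx Iz.
    have zx0 : z - x != 0 by rewrite gt_eqF.
    split; first by rewrite mulr_gt0 ?invr_gt0.
    apply: (is_derive_eq (is_derive_mul dp
      (is_derive_inv (f := fun t => t - x) zx0 (d1 z)))).
    rewrite /logder aE !hornerE /=; field.
    by rewrite zx0 Qz.
  + rewrite !hornerE /= h0 -Q0.
    by rewrite (_ : _ - _ - _ = 0) ?mul0r//; ring.
  + move=> z Iz; rewrite /bdterm aE hornerZ; field.
    by rewrite Qz// gt_eqF// wx.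
  + by rewrite hornerZ mulf_neq0.
  + rewrite NE h0 -Q0.
    have -> : 2 * (Q.[x] * (4 * Q.[x])) - (4 * Q.[x]) ^+ 2 = - 8 * Q.[x] ^+ 2 by ring.
    by rewrite mulf_neq0 ?expf_neq0// oppr_eq0.
  + by have [] := red_bd redL.
Qed.

(** At a double zero of a4 the weight behaves like (z - x)^m with
    m = a3'(x) / a4''(x) - 2; the vanishing of a3 p, or of a4 p if
    a3'(x) = 0, then says that m > -1. *)
Lemma lower_end_double : (a4 L)^`(2).[x] != 0 ->
  1 < (a3 L)^`().[x] / (a4 L)^`(2).[x] /\ (bdpoly L)^`(2).[x] = 0.
Proof.
have [ax0 dx0 hx0] := lower_end_zeros.
have [Q1 QE] := factor_root ax0.
have Q10 : Q1.[x] = 0.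
  by move: dx0; rewrite QE !poly.derivE !hornerE /= subrr mulr0 add0r.
have [Q Q1E] := factor_root Q10; have [H hE] := factor_root hx0.
have aE z : (a4 L).[z] = Q.[z] * (z - x) * (z - x) by rewrite QE Q1E !hornerE.
have h3E z : (a3 L).[z] = H.[z] * (z - x) by rewrite hE !hornerE.
have daE z : (a4 L)^`().[z] = Q^`().[z] * (z - x) ^+ 2 + 2 * Q.[z] * (z - x).
  by rewrite QE Q1E !poly.derivE !hornerE /=; ring.
have dhE z : (a3 L)^`().[z] = H^`().[z] * (z - x) + H.[z].
  by rewrite hE !poly.derivE !hornerE /=; ring.
have -> : (a4 L)^`(2).[x] = 2 * Q.[x].
  by rewrite !derivnS derivn0 QE Q1E !poly.derivE !hornerE /=; ring.
have -> : (a3 L)^`().[x] = H.[x] by rewrite dhE subrr mulr0 add0r.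
move=> Q20; have Q0 : Q.[x] != 0 by apply: contraNneq Q20 => ->; rewrite mulr0.
have Qz z : itv_of x%:E r z -> Q.[z] != 0.
  by move=> /a40; rewrite aE !mulf_eq0 !negb_or -andbA => /and3P[].
have dQ0 : (2 *: Q).[x] != 0 by rewrite hornerZ mulf_neq0.
pose n0 : {poly R} := H - 4 *: Q - 2 *: (Q^`() * ('X - x%:P)).
split.
- rewrite ltNge; apply/negP => le1.
  have [H0|H0] := eqVneq H.[x] 0.
  + apply: (@not_lower0 _ x r (fun z => (z - x) * ((z - x) * p z))
      (fun z => (a4 L).[z] * p z) (n0 + 4 *: Q) (2 *: Q) Q 1 xr) => //.
    * move=> z Iz; have [pz dp] := red_weight redL Iz; have zx := wx Iz.
      split; first by rewrite !mulr_gt0.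
      apply: (is_derive_eq (is_derive_mul (d1 z) (is_derive_mul (d1 z) dp))).
      rewrite /logder aE daE h3E /n0 !hornerE /=; field.
      by rewrite gt_eqF//= Qz.
    * by rewrite /n0 !hornerE /= H0 subrr mulr0 subr0 sub0r addNr mul0r.
    * by move=> z Iz; rewrite aE !hornerE /=; field.
    * by rewrite !hornerE oner_neq0.
    * by have [] := red_a4 redL.
  + apply: (@not_lower0 _ x r (fun z => (z - x) * p z)
      (fun z => (a3 L).[z] * p z) (n0 + 2 *: Q) (2 *: Q) H 1 xr) => //.
    * move=> z Iz; have [pz dp] := red_weight redL Iz; have zx := wx Iz.
      split; first by rewrite !mulr_gt0.
      apply: (is_derive_eq (is_derive_mul (d1 z) dp)).
      rewrite /logder aE daE h3E /n0 !hornerE /=; field.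
      by rewrite gt_eqF//= Qz.
    * rewrite /n0 !hornerE /= subrr mulr0 subr0.
      have -> : (H.[x] - 4 * Q.[x] + 2 * Q.[x]) / (2 * Q.[x])
          = H.[x] / (2 * Q.[x]) - 1 by field.
      by rewrite subr_le0.
    * by move=> z Iz; rewrite h3E !hornerE /=; field.
    * by rewrite !hornerE oner_neq0.
    * by have [] := red_a3 redL.
- pose n : {poly R} := 4 *: (Q * a2 L) - 2 *: (Q * (a3 L)^`())
    + 2 *: (Q^`() * H * ('X - x%:P) + 2 *: (Q * H)) - H ^+ 2.
  have NE : bdpoly L = n * ('X - x%:P) ^+ 2.
    apply: poly_ext => z; rewrite bdpoly_horner aE daE h3E /n !hornerE /=.
    by ring.
  have -> : (bdpoly L)^`(2).[x] = 2 * n.[x].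
    rewrite !derivnS derivn0 NE; move: n {NE} => n.
    by rewrite !poly.derivE !hornerE /=; ring.
  apply/eqP; rewrite mulf_eq0 pnatr_eq0 /=; apply/negPn/negP => n0x.
  have : n.[x] * (H.[x] - 4 * Q.[x]) = 0.
    have E : 2 *: (Q * (n^`() * ('X - x%:P) + 2 *: n))
        + n * (H - 8 *: Q - 4 *: (Q^`() * ('X - x%:P)))
        = 8 *: (Q ^+ 2 * a1 L * ('X - x%:P)).
      have X3 : ('X - x%:P) ^+ 3 != 0 :> {poly R} by rewrite expf_neq0// polyXsubC_eq0.
      apply: (mulIf X3); apply: poly_ext => z.
      have := moment_eq_horner z (red_moment redL); rewrite NE aE daE h3E.
      clearbody n; rewrite !poly.derivE !hornerE /= => me.
      by apply: etrans (etrans _ me) _; ring.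
    have := congr1 (fun P => P.[x]) E; clearbody n.
    rewrite /= !hornerE /= => Ex.
    by apply: etrans (etrans _ Ex) _; ring.
  move/eqP; rewrite mulf_eq0 (negPf n0x) /= subr_eq0 => /eqP HQ.
  apply: (@not_lower0 _ x r p (bdterm L p) n0 (2 *: Q) n (4 *: Q) xr) => //.
  + move=> z Iz; have [pz dp] := red_weight redL Iz; have zx := wx Iz.
    split => //; apply: (is_derive_eq dp).
    rewrite /logder aE daE h3E /n0 !hornerE /=; field.
    by rewrite gt_eqF//= Qz.
  + by rewrite /n0 !hornerE /= HQ !subrr mulr0 subr0 mul0r.
  + move=> z Iz; rewrite /bdterm NE aE; clearbody n; rewrite !hornerE /=; field.
    by rewrite Qz// gt_eqF// wx.
  + by rewrite hornerZ mulf_neq0.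
  + by have [] := red_bd redL.
Qed.

End EndpointMultiplicities.

(** * Polynomials and integrals near infinity *)

Section InfiniteEndpoint.
Variable R : realType.
Implicit Types (l : \bar R) (x y : R) (L : diffop R) (p f g v : R -> R).
Implicit Types (P Q : {poly R}).

Lemma lead_coef_coef_gt0 P n : (size P <= n.+1)%N -> 0 < P`_n -> 0 < lead_coef P.
Proof.
move=> sP Pn; suff -> : lead_coef P = P`_n by [].
rewrite lead_coefE; congr (_`_ _).
have : (n < size P)%N.
  by rewrite ltnNge; apply/negP => h; move: Pn; rewrite nth_default ?ltxx.
by lia.
Qed.

(** If the leading coefficient of Q is positive, so are those of K Q + P and
    K Q - P for large K. *)
Lemma poly_dominated P Q : Q != 0 -> (size P <= size Q)%N ->
  exists K X, forall x, X <= x -> `|P.[x]| <= K * `|Q.[x]|.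
Proof.
wlog lQ : Q / 0 < lead_coef Q => [wl|] Q0 sPQ.
  have [lQ|lQ|/eqP] := ltrgt0P (lead_coef Q); first exact: wl.
  - have [|||K [X h]] := wl (- Q).
    + by rewrite lead_coefN oppr_gt0.
    + by rewrite oppr_eq0.
    + by rewrite size_polyN.
    exists K, X => x /h; by rewrite hornerN normrN.
  - by rewrite lead_coef_eq0 (negPf Q0).
pose n := (size Q).-1; pose K := `|P`_n| / lead_coef Q + 1.
have sQ : size Q = n.+1 by rewrite prednK// size_poly_gt0.
have KQ : `|P`_n| < (K *: Q)`_n.
  by rewrite coefZ -lead_coefE /K mulrDl mul1r divfK ?gt_eqF// ltrDl.
have sK : (size (K *: Q) <= n.+1)%N by rewrite -sQ size_scale_leq.
have lp : 0 < lead_coef (K *: Q + P).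
  apply: (@lead_coef_coef_gt0 _ n).
    by rewrite (leq_trans (size_polyD _ _))// geq_max sK -sQ.
  by move: KQ; rewrite coefD ltr_norml => /andP[]; lra.
have lm : 0 < lead_coef (K *: Q - P).
  apply: (@lead_coef_coef_gt0 _ n).
    by rewrite (leq_trans (size_polyD _ _))// geq_max sK size_polyN -sQ.
  by move: KQ; rewrite coefB ltr_norml => /andP[]; lra.
have [X1 h1] := poly_pinfty_gt_lc lp; have [X2 h2] := poly_pinfty_gt_lc lm.
have [X3 h3] := poly_pinfty_gt_lc lQ.
exists K, (Num.max X1 (Num.max X2 X3)) => x; rewrite !ge_max => /and3P[x1 x2 x3].
have := lt_le_trans lp (h1 x x1); have := lt_le_trans lm (h2 x x2).
have Qx := lt_le_trans lQ (h3 x x3).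
by rewrite (gtr0_norm Qx) !hornerE ler_norml => ? ?; apply/andP; split; lra.
Qed.

(** The derivative of f ^ 2 is 2 f ^ 2 rho. *)
Lemma norm_nondecreasing f rho x y : x <= y ->
  (forall z, x <= z <= y -> is_derive z 1 f (f z * rho z)) ->
  (forall z, x <= z <= y -> 0 <= rho z) -> `|f x| <= `|f y|.
Proof.
move=> xy df r0; rewrite -ler_sqr ?nnegrE ?normr_ge0// !real_normK ?num_real//.
rewrite !expr2.
apply: (@derivative_ge0_homo _ (fun t => f t * f t)
  (fun t => f t * rho t * f t + f t * (f t * rho t))) => // z Iz.
- by apply: is_derive_mul; exact: df.
- have -> : f z * rho z * f z + f z * (f z * rho z) = 2 * (f z ^+ 2 * rho z) by ring.
  by rewrite mulr_ge0// mulr_ge0 ?sqr_ge0// r0.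
Qed.

Lemma itv_of_right l x y : itv_of l +oo%E x -> x <= y -> itv_of l +oo%E y.
Proof.
by move=> [lx _] xy; split; [apply: lt_le_trans lx _; rewrite lee_fin|rewrite ltry].
Qed.

Lemma admissible_not_bounded_below l p (u : {poly R}) X e : 0 < e ->
  measurable_fun (itv_of l +oo%E) p ->
  (forall x, itv_of l +oo%E x -> 0 <= p x) -> itv_of l +oo%E X ->
  (forall x, X <= x -> e <= p x * `|u.[x]|) -> ~ admissible (itv_of l +oo%E) p.
Proof.
move=> e0 mp p0 IX pu adm; have := adm u; apply/negP; rewrite -leNgt.
have mI : measurable (itv_of l +oo%E) by apply: open_measurable; exact: itv_of_open.
have sub : `[X, +oo[%classic `<=` itv_of l +oo%E.
  by move=> x /=; rewrite in_itv /= andbT => /(itv_of_right IX).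
have mf : measurable_fun (itv_of l +oo%E) (fun x => (p x * `|u.[x]|)%:E).
  apply/measurable_EFinP; apply: measurable_funM => //.
  apply: measurableT_comp => //; apply: measurable_funTS.
  by apply: continuous_measurable_fun; exact: continuous_horner.
have f0 x : itv_of l +oo%E x -> (0 <= (p x * `|u.[x]|)%:E)%E.
  by move=> Ix; rewrite lee_fin mulr_ge0// p0.
apply: (@le_trans _ _ (\int[@lebesgue_measure R]_(x in `[X, +oo[) (p x * `|u.[x]|)%:E)%E);
  last exact: ge0_subset_integral.
apply: (@le_trans _ _ (\int[@lebesgue_measure R]_(x in `[X, +oo[) e%:E)%E).
  have mX : @lebesgue_measure R `[X, +oo[%classic = +oo%E.
    by rewrite lebesgue_measure_itv/= ltry.
  by rewrite integral_cst// [X in (_ <= _ * X)%E]mX mulry gtr0_sg// mul1e.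
apply: ge0_le_integral => //.
- by move=> x _; rewrite lee_fin ltW.
- exact: measurable_funS mf.
- by move=> x /=; rewrite in_itv /= andbT lee_fin => /pu.
Qed.

End InfiniteEndpoint.

(** * Degrees at an infinite endpoint *)

Section InfiniteEndpointDegrees.
Variable R : realType.
Variables (L : diffop R) (l : \bar R) (p : R -> R).
Hypothesis redL : reduced L l +oo%E p.

Let a40 x : itv_of l +oo%E x -> (a4 L).[x] != 0.
Proof. by have [_ rL _ _] := red_itv redL; exact: rL. Qed.

Let a4n0 : a4 L != 0. Proof. by have [] := red_form redL. Qed.

(** If a3 had a smaller degree than a4, then a3 / a4 = O(1/x) and p would
    decay at most like a power of x. *)
Lemma upper_infinite_growth : (size (a4 L) <= size (a3 L))%N.
Proof.
rewrite leqNgt; apply/negP => lt34.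
have sX : (size (a3 L * 'X)%R <= size (a4 L))%N.
  have [->|h0] := eqVneq (a3 L) 0; first by rewrite mul0r size_poly0.
  by rewrite size_mulX.
have [K [X hK]] := poly_dominated a4n0 sX.
have [m Km] : exists m : nat, K <= m%:R.
  by exists (Num.bound `|K|); apply: ltW; exact: (le_lt_trans (ler_norm K) (archi_boundP (normr_ge0 K))).
have [lr _ _ _] := red_itv redL; have [x0 I0] := itv_of_nonempty lr.
pose Y := Num.max x0 (Num.max X 1).
have IY : itv_of l +oo%E Y by apply: itv_of_right I0 _; rewrite le_max lexx.
have Y1 : 1 <= Y by rewrite !le_max lexx !orbT.
have XY : X <= Y by rewrite !le_max lexx !orbT.
(* |u p| is nondecreasing near infinity, because the factor X^m makes its
   logarithmic derivative nonnegative. *)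
pose u := a4 L * 'X^m.
pose rho x := (a3 L).[x] / (2 * (a4 L).[x]) + m%:R / x.
have du x : Y <= x -> is_derive x 1 (fun t => u.[t] * p t) (u.[x] * p x * rho x).
  move=> Yx; have Ix := itv_of_right IY Yx.
  have x0' : x != 0 by rewrite gt_eqF// (lt_le_trans ltr01)// (le_trans Y1).
  apply: (is_derive_eq (is_derive_poly_weight u (red_weight redL) Ix)).
  have dm : m%:R * x ^+ m.-1 = m%:R * (x ^+ m / x).
    by case: (m) => [|k]; rewrite ?mul0r//= exprSr mulfK.
  rewrite /u /logder /rho derivM derivXn !hornerE /= hornerMn hornerXn -[_ *+ m]mulr_natl.
  by rewrite dm; field; rewrite x0' a40.
have rho0 x : Y <= x -> 0 <= rho x.
  move=> Yx; have Ix := itv_of_right IY Yx.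
  have x1 : 0 < x by rewrite (lt_le_trans ltr01)// (le_trans Y1).
  have := hK x (le_trans XY Yx); rewrite hornerM hornerX normrM (gtr0_norm x1) => le.
  have a4x : 0 < `|(a4 L).[x]| by rewrite normr_gt0 a40.
  have : `|(a3 L).[x] / (a4 L).[x]| <= m%:R / x.
    rewrite normrM normfV ler_pdivrMr// mulrAC ler_pdivlMr//.
    by apply: le_trans le _; rewrite ler_pM2r.
  rewrite /rho ler_norml => /andP[h _].
  have -> : (a3 L).[x] / (2 * (a4 L).[x]) = (a3 L).[x] / (a4 L).[x] / 2.
    by field; rewrite a40.
  have : 0 <= m%:R / x by rewrite divr_ge0// ltW.
  by lra.
have pos x : itv_of l +oo%E x -> 0 < p x by move=> /(red_weight redL)[].
have uY : 0 < `|u.[Y] * p Y|.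
  rewrite normr_gt0 mulf_neq0 ?(gt_eqF (pos Y IY))//.
  by rewrite /u hornerM hornerXn mulf_neq0 ?a40// expf_neq0// gt_eqF// (lt_le_trans ltr01).
apply: (admissible_not_bounded_below (u := u) uY _ _ IY _ (red_adm redL)).
- apply: open_continuous_measurable_fun; first exact: itv_of_open.
  by move=> x /set_mem /(red_weight redL)[_ /is_derive_continuous].
- by move=> x /pos/ltW.
- move=> x Yx; have -> : p x * `|u.[x]| = `|u.[x] * p x|.
    by rewrite normrM (gtr0_norm (pos _ (itv_of_right IY Yx))) mulrC.
  apply: (@norm_nondecreasing _ (fun t => u.[t] * p t) rho) => //.
  + by move=> z /andP[Yz _]; exact: du.
  + by move=> z /andP[Yz _]; exact: rho0.
Qed.

(** Otherwise |a4 p| would increase near infinity, and could not tend to 0. *)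
Lemma upper_infinite_sign : lead_coef (a4 L) * lead_coef (a3 L) < 0.
Proof.
rewrite ltNge; apply/negP => ge0.
have h0 : a3 L != 0.
  by rewrite -size_poly_gt0 (leq_trans _ upper_infinite_growth)// size_poly_gt0.
have pr : 0 < lead_coef (a4 L * a3 L).
  by rewrite lead_coefM lt_def ge0 mulf_neq0 ?lead_coef_eq0.
have [X hX] := poly_pinfty_gt_lc pr.
have [lr _ _ _] := red_itv redL; have [x0 I0] := itv_of_nonempty lr.
pose Y := Num.max x0 X.
have IY : itv_of l +oo%E Y by apply: itv_of_right I0 _; rewrite le_max lexx.
have XY : X <= Y by rewrite le_max lexx orbT.
have pos x : itv_of l +oo%E x -> 0 < p x by move=> /(red_weight redL)[].
have [_ up] := red_a4 redL.
have qY : 0 < `|(a4 L).[Y] * p Y|.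
  by rewrite normr_gt0 mulf_neq0 ?a40// (gt_eqF (pos Y IY)).
have [y Iy hy] := up _ qY; pose z := Num.max Y (y + 1).
have Yz : Y <= z by rewrite le_max lexx.
have := hy z (itv_of_right IY Yz).
have -> : y < z by rewrite lt_max ltrDl ltr01 orbT.
move=> /(_ isT); apply/negP; rewrite -leNgt.
apply: (@norm_nondecreasing _ (fun t => (a4 L).[t] * p t)
  (fun t => (a3 L).[t] / (2 * (a4 L).[t]))) => //.
- move=> t /andP[Yt _]; have It := itv_of_right IY Yt.
  apply: (is_derive_eq (is_derive_poly_weight (a4 L) (red_weight redL) It)).
  by rewrite /logder; field; rewrite a40.
- move=> t /andP[Yt _]; have It := itv_of_right IY Yt.
  have := lt_le_trans pr (hX t (le_trans XY Yt)); rewrite hornerM => p1.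
  have -> : (a3 L).[t] / (2 * (a4 L).[t])
      = (a4 L).[t] * (a3 L).[t] / (2 * (a4 L).[t] ^+ 2) by field; rewrite a40.
  by rewrite divr_ge0 ?(ltW p1)// mulr_ge0// sqr_ge0.
Qed.

(** If 2 deg a3 > deg a4 + 2, then - a3 ^ 2 dominates N, and N a3 dominates the
    moment equation. *)
Lemma upper_infinite_degrees : (2 * size (a3 L) <= size (a4 L) + 3)%N.
Proof.
have s43 := upper_infinite_growth.
have [_ _ s2 s1 _] := red_form redL.
have a4pos : (0 < size (a4 L))%N by rewrite size_poly_gt0.
rewrite leqNgt; apply/negP => big.
have me := red_moment redL.
have h0 : a3 L != 0 by rewrite -size_poly_gt0 (leq_trans a4pos).
have mulb (P Q : {poly R}) : (size (P * Q)%R <= (size P + size Q).-1)%N.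
  exact: size_polyMleq.
have sd (P : {poly R}) : (size P^`() <= (size P).-1)%N.
  have [->|P0] := eqVneq P 0; first by rewrite deriv0 size_poly0.
  by have := lt_size_deriv P0; lia.
have addb (P Q : {poly R}) n : (size P <= n)%N -> (size Q <= n)%N ->
    (size (P + Q)%R <= n)%N.
  by move=> sP sQ; rewrite (leq_trans (size_polyD P Q))// geq_max sP sQ.
have scb (d : R) (P : {poly R}) n : (size P <= n)%N -> (size (d *: P) <= n)%N.
  exact: leq_trans (size_scale_leq d P).
have sh2 : size (a3 L ^+ 2) = (2 * size (a3 L)).-1.
  by rewrite expr2 size_mul// mul2n addnn.
have sN : size (bdpoly L) = (2 * size (a3 L)).-1.
  rewrite /bdpoly addrC size_polyDl size_polyN sh2//.
  have -> : (2 * size (a3 L)).-1 = (2 * size (a3 L)).-2.+1 by lia.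
  rewrite ltnS; apply: (addb _ _ _); first apply: (addb _ _ _).
  - by apply: (scb _ _ _); apply: leq_trans (mulb _ _) _; lia.
  - rewrite size_polyN; apply: (scb _ _ _); apply: leq_trans (mulb _ _) _.
    by have := sd (a3 L); lia.
  - by apply: (scb _ _ _); apply: leq_trans (mulb _ _) _; have := sd (a4 L); lia.
have N0 : bdpoly L != 0 by rewrite -size_poly_gt0 sN; lia.
pose S := 8 *: (a4 L ^+ 2 * a1 L) - 2 *: (a4 L * (bdpoly L)^`())
    + 4 *: (bdpoly L * (a4 L)^`()).
have SE : bdpoly L * a3 L = S.
  move: (red_moment redL); rewrite /S /moment_eq; move: (bdpoly L) => N <-.
  by apply: poly_ext => t; rewrite !hornerE /=; ring.
have sE : size S = ((2 * size (a3 L)).-1 + size (a3 L)).-1.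
  by rewrite -SE size_mul// sN.
have [b3|b3] := leqP (size (a3 L)) 2%N.
  by lia.
suff : (size S <= 3 * size (a3 L) - 3)%N.
  by rewrite sE => le; lia.
apply: (addb _ _ _); first apply: (addb _ _ _).
- apply: (scb _ _ _); apply: leq_trans (mulb _ _) _.
  by have := mulb (a4 L) (a4 L); rewrite -expr2; lia.
- rewrite size_polyN; apply: (scb _ _ _); apply: leq_trans (mulb _ _) _.
  by have := sd (bdpoly L); rewrite sN; lia.
- apply: (scb _ _ _); apply: leq_trans (mulb _ _) _.
  by have := sd (a4 L); rewrite sN; lia.
Qed.

End InfiniteEndpointDegrees.

(** * Operators and weights in normal form *)

Section Pullback.
Variable R : realType.
Implicit Types (l r : \bar R) (L M : diffop R) (p w : R -> R) (P : {poly R}).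

(** The operator L written in the variable t, where x = alpha t + beta. *)
Definition pullback (alpha beta : R) L : diffop R := {|
  a4 := alpha ^- 4 *: (a4 L \Po affX alpha beta);
  a3 := alpha ^- 3 *: (a3 L \Po affX alpha beta);
  a2 := alpha ^- 2 *: (a2 L \Po affX alpha beta);
  a1 := alpha^-1 *: (a1 L \Po affX alpha beta) |}.

Lemma same_coefs_pullback (alpha beta : R) L : alpha != 0 ->
  same_coefs alpha beta 1 L (pullback alpha beta L).
Proof.
move=> a0; split; rewrite /= scalerA mul1r ?divff ?scale1r// expf_neq0//.
Qed.

Lemma same_coefs_pullback_inv (alpha beta : R) L : alpha != 0 ->
  same_coefs alpha^-1 (- beta / alpha) 1 (pullback alpha beta L) L.
Proof.
move=> a0.
have K P : (P \Po affX alpha beta) \Po affX alpha^-1 (- beta / alpha) = P.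
  by apply: poly_ext => t; rewrite !horner_affX; congr horner; field.
split; rewrite /= comp_polyZ K ?mul1r ?exprVn ?div1r //.
Qed.

Lemma reduced_pullback (alpha beta : R) L l r l' r' p : alpha != 0 ->
  (forall t, itv_of l' r' t <-> itv_of l r (alpha * t + beta)) ->
  reduced L l r p ->
  reduced (pullback alpha beta L) l' r' (fun t => p (alpha * t + beta)).
Proof.
move=> a0 IE redL.
have K x : alpha * (alpha^-1 * x + - beta / alpha) + beta = x by field.
have ai0 : alpha^-1 != 0 by rewrite invr_eq0.
have IE' x : itv_of l r x <-> itv_of l' r' (alpha^-1 * x + - beta / alpha).
  by rewrite IE K.
have pE x : itv_of l r x ->
    p (alpha * (alpha^-1 * x + - beta / alpha) + beta) = 1 * p x.
  by rewrite K mul1r.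
exact: (reduced_affine ai0 (oner_neq0 R) ltr01 (same_coefs_pullback_inv beta L a0)
  IE' pE redL).
Qed.

Lemma polyE2 P : (size P <= 2)%N -> P = (P`_0)%:P + P`_1 *: 'X.
Proof.
move=> sP; apply: poly_ext => x; rewrite (horner_coef_wide _ sP).
by rewrite !big_ord_recr big_ord0 /= !hornerE /=; ring.
Qed.

Lemma polyE3 P : (size P <= 3)%N -> P = (P`_0)%:P + P`_1 *: 'X + P`_2 *: 'X^2.
Proof.
move=> sP; apply: poly_ext => x; rewrite (horner_coef_wide _ sP).
by rewrite !big_ord_recr big_ord0 /= !hornerE /=; ring.
Qed.

Lemma polyE4 P : (size P <= 4)%N ->
  P = (P`_0)%:P + P`_1 *: 'X + P`_2 *: 'X^2 + P`_3 *: 'X^3.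
Proof.
move=> sP; apply: poly_ext => x; rewrite (horner_coef_wide _ sP).
by rewrite !big_ord_recr big_ord0 /= !hornerE /=; ring.
Qed.

Lemma polyE5 P : (size P <= 5)%N ->
  P = (P`_0)%:P + P`_1 *: 'X + P`_2 *: 'X^2 + P`_3 *: 'X^3 + P`_4 *: 'X^4.
Proof.
move=> sP; apply: poly_ext => x; rewrite (horner_coef_wide _ sP).
by rewrite !big_ord_recr big_ord0 /= !hornerE /=; ring.
Qed.

Lemma cubic_eq0 (c0 c1 c2 c3 : R) :
  (forall x, c0 + c1 * x + c2 * x ^+ 2 + c3 * x ^+ 3 = 0) ->
  [/\ c0 = 0, c1 = 0, c2 = 0 & c3 = 0].
Proof.
move=> h; have := h 0; have := h 1; have := h (-1); have := h 2.
by move=> h2 hm h1 h0; split; lra.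
Qed.

Lemma logder_same_coefs (c : R) L M x : c != 0 -> same_coefs 1 0 c L M ->
  (a4 M).[x] != 0 -> logder L x = logder M x.
Proof.
move=> c0 e a0; have [e4 e3 _ _] := same_coefs_horner e x.
have [d4 _] := same_coefs_deriv (oner_neq0 R) e x.
rewrite !mul1r !addr0 in e4 e3 d4; rewrite /logder e4 e3 d4 !expr1n !mulr1.
by field; rewrite a0.
Qed.

End Pullback.

Section Weights.
Variable R : realType.
Implicit Types (a b c m A B x : R).

Lemma is_weight_wA (m0 m1 m2 A : R) : is_weight (opA m1 m2 A) -oo%E +oo%E (wA m0 m1 m2).
Proof.
move=> x _; split; first exact: expR_gt0.
pose P : {poly R} := - (m2 ^+ 2 *: 'X^2) + m1 *: 'X + m0%:P.
have -> : wA m0 m1 m2 = fun t => expR P.[t].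
  by apply/funext => t; rewrite /wA /P !hornerE.
apply: (is_derive_eq (is_derive1_comp (f := expR) (g := horner P)
  (is_derive_expR P.[x]) (is_derive_horner P x))).
by rewrite /logder /P /= !poly.derivE !hornerE /=; field.
Qed.

Lemma is_weight_wB a b A : is_weight (opB a b A) 0%:E +oo%E (wB a b).
Proof.
move=> x [x0 _]; rewrite lte_fin in x0.
have pw0 : 0 < x `^ (a / 2 - 2) by rewrite powR_gt0.
split; first by rewrite /wB mulr_gt0 ?expR_gt0// gtr0_norm.
have wE y : itv_of 0%:E +oo%E y -> wB a b y = y `^ (a / 2 - 2) * expR (b / 2 * y).
  by move=> [y0 _]; rewrite /wB gtr0_norm// -lte_fin.
have Ix : itv_of 0%:E +oo%E x by split; rewrite ?lte_fin// ltry.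
apply: (is_derive_eq_on_itv Ix wE).
have dl : is_derive x 1 (fun y : R => b / 2 * y) (b / 2 * 1).
  by apply: is_derive_cmul.
have dE := is_derive1_comp (f := expR) (g := fun y => b / 2 * y)
  (is_derive_expR (b / 2 * x)) dl.
apply: (is_derive_eq (is_derive_mul (is_derive1_powR (a / 2 - 2) x0) dE)).
rewrite wE// /logder /= !poly.derivE !hornerE /=.
have -> : x `^ (a / 2 - 2 - 1) = x `^ (a / 2 - 2) / x.
  by rewrite powRB ?powRr1 ?ltW//; apply/implyP => _; rewrite gt_eqF.
by field; rewrite gt_eqF.
Qed.

(** One family for both values of the parameter b: with m = - B / b it is
    opC a b B, and with b = 0 and m = A - (a - 1) (a - 2) it is opC0 a A. *)
Definition opCm a b m : diffop R := {|
  a4 := a4C R;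
  a3 := a3C a b;
  a2 := (b%:P + (a - 2) *: 'X) ^+ 2 + (2 * b) *: 'X + (a - 2) *: (1 + 'X^2)
        + m *: ('X^2 - 1);
  a1 := - m *: (b%:P + a *: 'X) |}.

Lemma opC0E a A : opC0 a A = opCm a 0 (A - (a - 1) * (a - 2)).
Proof.
rewrite /opC0 /opCm; congr DiffOp; apply: poly_ext => x; rewrite !hornerE /=; ring.
Qed.

Lemma opCE a b B : b != 0 -> opC a b B = opCm a b (- B / b).
Proof.
move=> b0; rewrite /opC /opCm; congr DiffOp; apply: poly_ext => x;
  rewrite !hornerE /=; field; exact: b0.
Qed.

Lemma is_weight_wC a b m : is_weight (opCm a b m) (-1)%:E 1%:E (wC a b).
Proof.
move=> x [x0 x1]; rewrite !lte_fin in x0 x1.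
have xm : 0 < 1 - x by lra.
have xp : 0 < 1 + x by lra.
split; first by rewrite /wC mulr_gt0 ?powR_gt0.
pose e1 := (- 2 - a - b) / 2; pose e2 := (- 2 - a + b) / 2.
have dm : is_derive x 1 (fun y : R => 1 - y) (0 - 1).
  apply: is_derive_add; exact: is_derive_opp.
have dp : is_derive x 1 (fun y : R => 1 + y) (0 + 1) by apply: is_derive_add.
have d1 := is_derive1_comp (f := fun y => y `^ e1) (g := fun y => 1 - y)
  (is_derive1_powR e1 xm) dm.
have d2 := is_derive1_comp (f := fun y => y `^ e2) (g := fun y => 1 + y)
  (is_derive1_powR e2 xp) dp.
apply: (is_derive_eq (is_derive_mul d1 d2)).
have pw y e : 0 < y -> y `^ (e - 1) = y `^ e / y.
  by move=> y0; rewrite powRB ?powRr1 ?ltW//; apply/implyP => _; rewrite gt_eqF.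
rewrite !pw// /logder /wC -/e1 -/e2 /= /a4C /a3C !poly.derivE !hornerE /= /e1 /e2.
field.
have x2 : 0 < 1 - x ^+ 2.
  by rewrite (_ : _ - _ = (1 - x) * (1 + x)) ?mulr_gt0//; ring.
by rewrite !gt_eqF.
Qed.

End Weights.

(** * Classification on the three model intervals *)

Section NormalForms.
Variable R : realType.
Implicit Types (l r : \bar R) (L M : diffop R) (p w : R -> R) (P : {poly R}).

Lemma same_coefs_scale (c : R) L M :
  a4 L = c *: a4 M -> a3 L = c *: a3 M -> a2 L = c *: a2 M -> a1 L = c *: a1 M ->
  same_coefs 1 0 c L M.
Proof.
have X1 : affX 1 0 = 'X :> {poly R} by rewrite /affX scale1r addr0.
by move=> e4 e3 e2 e1; split; rewrite X1 comp_polyXr ?expr1n mulr1.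
Qed.

Lemma weight_same_coefs (c : R) L M l r p w : c != 0 -> same_coefs 1 0 c L M ->
  reduced L l r p -> is_weight M l r w ->
  exists2 k, 0 < k & forall x, itv_of l r x -> p x = k * w x.
Proof.
move=> c0 e redL wM; have [lr rL _ _] := red_itv redL.
apply: (eq_logderivative lr (red_weight redL)) => x Ix.
have [w0 dw] := wM x Ix; split=> //.
have a0 : (a4 M).[x] != 0.
  have := rL x Ix; rewrite /root; have [] := same_coefs_horner e x.
  by rewrite mul1r addr0 => -> _ _ _; rewrite mulf_eq0 negb_or => /andP[].
by rewrite (logder_same_coefs c0 e a0).
Qed.

(** The results at a lower endpoint, transported by the reflection x |-> - x. *)
Lemma upper_end_double L l x p : reduced L l x%:E p ->
  [/\ (a4 L).[x] = 0, (a4 L)^`().[x] = 0 & (a3 L).[x] = 0] /\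
  ((a4 L)^`(2).[x] != 0 ->
    1 < (a3 L)^`().[x] / (a4 L)^`(2).[x] /\ (bdpoly L)^`(2).[x] = 0).
Proof.
move=> redL; have N10 : -1 != 0 :> R by rewrite oppr_eq0 oner_neq0.
have IE (t : R) : itv_of (- x)%:E (- l)%E t <-> itv_of l x%:E (-1 * t + 0).
  rewrite /itv_of /= addr0 mulN1r EFinN lteNl lteNr EFinN.
  by split=> -[? ?]; split => //; rewrite lteNl.
have redM := reduced_pullback N10 IE redL.
have e := same_coefs_pullback 0 L N10.
have K : -1 * - x + 0 = x by ring.
have [e4 e3 _ _] := same_coefs_horner e (- x).
have [d4 d3] := same_coefs_deriv N10 e (- x).
have b := bdpoly_affine N10 e.
have dd P Q : P \Po affX (-1) 0 = Q -> P^`(2).[x] = Q^`(2).[- x].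
  move=> <-; rewrite derivn_affX hornerZ horner_affX K.
  by rewrite sqrrN expr1n mul1r.
have d24 : (a4 L)^`(2).[x] = (a4 (pullback (-1) 0 L))^`(2).[- x].
  by apply: dd; have [-> _ _ _] := e; rewrite mul1r -signr_odd /= expr0 scale1r.
have d2N : (bdpoly L)^`(2).[x] = (bdpoly (pullback (-1) 0 L))^`(2).[- x].
  by apply: dd; rewrite b expr1n mul1r -signr_odd /= expr0 scale1r.
rewrite !K in e4 e3 d4 d3.
have [z4 z4' z3] := lower_end_zeros redM.
rewrite d24 d2N e4 e3 d4 d3 z4 z4' z3 !mulr0; split=> // nz.
have [h1 h2] := lower_end_double redM nz; split=> //.
by rewrite sqrrN expr1n !mul1r.
Qed.

Lemma quadratic_eq0 (c0 c1 c2 : R) :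
  (forall x, x != 0 -> c0 + c1 * x + c2 * x ^+ 2 = 0) ->
  [/\ c0 = 0, c1 = 0 & c2 = 0].
Proof.
move=> h; have := h 1 (oner_neq0 _); have := h (-1).
rewrite oppr_eq0 oner_neq0 => /(_ isT); have := h 2; rewrite pnatr_eq0 => /(_ isT).
by move=> h2 hm h1; split; lra.
Qed.

(** The reflection preserves the interval, and the signs of a3 / a4 at both
    ends force deg a3 + deg a4 to be odd; with the bounds on the degrees this
    leaves deg a4 = 0 and deg a3 = 1. The moment equation then reads
    2 c N' + N a3 = 8 c ^ 2 a1 with deg a1 <= 1, so that N is constant. *)
Lemma reduced_line L p : reduced L -oo%E +oo%E p ->
  exists m0 m1 m2 A c : R, [/\ m2 != 0, c != 0, forall x, p x = wA m0 m1 m2 x &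
    same_coefs 1 0 c L (opA m1 m2 A)].
Proof.
move=> redL; have N10 : -1 != 0 :> R by rewrite oppr_eq0 oner_neq0.
have IE (t : R) : itv_of -oo%E +oo%E t <-> itv_of -oo%E +oo%E (-1 * t + 0).
  by split=> _; split; rewrite ?ltNyr ?ltry.
have redM := reduced_pullback N10 IE redL.
have [s4 s3 s2 s1 a0] := red_form redL.
have g1 := upper_infinite_growth redL; have g2 := upper_infinite_degrees redL.
have sg := upper_infinite_sign redL.
have a4pos : (0 < size (a4 L))%N by rewrite size_poly_gt0.
have pb (P : {poly R}) : lead_coef (P \Po affX (-1) 0) = (-1) ^+ (size P).-1 * lead_coef P.
  rewrite lead_coef_comp ?size_affX// mulrC; congr (_ ^+ _ * _).
  by rewrite lead_coefE size_affX// /affX coefD coefZ coefX coefC /= mulr1 addr0.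
have := upper_infinite_sign redM; rewrite /= !lead_coefZ !pb => sg'.
have n4 : (-1) ^- 4 = 1 :> R by rewrite -signr_odd /= expr0 invr1.
have n3 : (-1) ^- 3 = -1 :> R by rewrite -signr_odd /= expr1 invrN1.
rewrite n4 n3 in sg'.
have [sz4 sz3] : size (a4 L) = 1%N /\ size (a3 L) = 2%N.
  have [?|eq] : (size (a4 L) = 1%N /\ size (a3 L) = 2%N) \/ size (a3 L) = size (a4 L).
  - by lia.
  - by [].
  exfalso; move: sg'; rewrite eq.
  have -> : 1 * ((-1) ^+ (size (a4 L)).-1 * lead_coef (a4 L)) *
    (-1 * ((-1) ^+ (size (a4 L)).-1 * lead_coef (a3 L))) =
    - ((-1) ^+ (size (a4 L)).-1) ^+ 2 * (lead_coef (a4 L) * lead_coef (a3 L)) by ring.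
  by rewrite sqrr_sign; lra.
have E4 := size1_polyC (eq_leq sz4).
have E3 : a3 L = ((a3 L)`_0)%:P + (a3 L)`_1 *: 'X by apply: polyE2; rewrite sz3.
rewrite !lead_coefE sz4 sz3 /= in sg.
have E2 := polyE3 s2; have E1 := polyE2 s1.
set k := (a4 L)`_0 in E4 sg; set h0 := (a3 L)`_0 in E3.
set h1 := (a3 L)`_1 in E3 sg.
set e0 := (a2 L)`_0 in E2; set e1 := (a2 L)`_1 in E2; set e2 := (a2 L)`_2 in E2.
set f0 := (a1 L)`_0 in E1; set f1 := (a1 L)`_1 in E1.
clearbody k h0 h1 e0 e1 e2 f0 f1.
have k0 : k != 0 by apply/eqP => K; move: sg; rewrite K mul0r ltxx.
have h10 : h1 != 0 by apply/eqP => K; move: sg; rewrite K mulr0 ltxx.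
pose n0 := 4 * k * e0 - 2 * k * h1 - h0 ^+ 2.
pose n1 := 4 * k * e1 - 2 * h0 * h1.
pose n2 := 4 * k * e2 - h1 ^+ 2.
have NE : bdpoly L = n0%:P + n1 *: 'X + n2 *: 'X^2.
  apply: poly_ext => x; rewrite /bdpoly E4 E3 E2 !poly.derivE !hornerE /=.
  by rewrite /n0 /n1 /n2; ring.
have me x : 2 * k * (n1 + 2 * n2 * x) + (n0 + n1 * x + n2 * x ^+ 2) * (h0 + h1 * x)
    = 8 * k ^+ 2 * (f0 + f1 * x).
  have := moment_eq_horner x (red_moment redL).
  rewrite NE E4 E3 E1 !poly.derivE !hornerE /= => E.
  by apply: etrans (etrans _ E) _; ring.
have [c0 c1 c2 c3] : [/\ 2 * k * n1 + n0 * h0 - 8 * k ^+ 2 * f0 = 0,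
    4 * k * n2 + n0 * h1 + n1 * h0 - 8 * k ^+ 2 * f1 = 0,
    n1 * h1 + n2 * h0 = 0 & n2 * h1 = 0].
  apply: cubic_eq0 => x; rewrite -(subrr (8 * k ^+ 2 * (f0 + f1 * x))) -{1}me.
  by ring.
have n20 : n2 = 0 by move/eqP: c3; rewrite mulf_eq0 (negPf h10) orbF => /eqP.
have n10 : n1 = 0.
  by move/eqP: c2; rewrite n20 mul0r addr0 mulf_eq0 (negPf h10) orbF => /eqP.
pose m2 := Num.sqrt (- h1 / (4 * k)); pose m1 := h0 / (2 * k).
have m2E : m2 ^+ 2 = - h1 / (4 * k).
  rewrite sqr_sqrtr// mulNr oppr_ge0.
  have -> : h1 / (4 * k) = k * h1 / (4 * k ^+ 2) by field.
  by rewrite ler_pdivrMr ?mul0r ?(ltW sg)// mulr_gt0// exprn_even_gt0.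
have m20 : m2 != 0.
  by rewrite -sqrf_eq0 m2E mulf_neq0 ?oppr_eq0// invr_eq0 mulf_neq0.
have e2E : e2 = h1 ^+ 2 / (4 * k).
  have e : 4 * k * e2 = h1 ^+ 2 by apply/eqP; rewrite -subr_eq0 -/n2 n20.
  by rewrite -e; field.
have e1E : e1 = h0 * h1 / (2 * k).
  have e : 4 * k * e1 = 2 * h0 * h1 by apply/eqP; rewrite -subr_eq0 -/n1 n10.
  have -> : e1 = 4 * k * e1 / (4 * k) by field.
  by rewrite e; field.
have f0E : f0 = n0 * h0 / (8 * k ^+ 2).
  have e : 8 * k ^+ 2 * f0 = n0 * h0.
    by apply/esym/eqP; rewrite -subr_eq0 -c0 n10 mulr0 add0r.
  by rewrite -e; field.
have f1E : f1 = n0 * h1 / (8 * k ^+ 2).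
  have e : 8 * k ^+ 2 * f1 = n0 * h1.
    by apply/esym/eqP; rewrite -subr_eq0 -c1 n10 n20 mulr0 mul0r add0r addr0.
  by rewrite -e; field.
pose A := e0 / k.
have h1E : h1 = - (4 * k * m2 ^+ 2) by rewrite m2E; field.
have h0E : h0 = 2 * k * m1 by rewrite /m1; field.
have e0E : e0 = k * A by rewrite /A; field.
clearbody m1 m2 A.
rewrite /n0 e0E h0E h1E in f0E f1E; rewrite h0E h1E in e1E e2E E3.
rewrite e0E e1E e2E in E2; rewrite f0E f1E in E1.
have coefs : same_coefs 1 0 k L (opA m1 m2 A).
  apply: same_coefs_scale; apply: poly_ext => x.
  - by rewrite E4 /= !hornerE /=.
  - by rewrite E3 /= !hornerE /=; ring.
  - by rewrite E2 /= !hornerE /=; field.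
  - by rewrite E1 /= !hornerE /=; field.
have [K K0 pK] := weight_same_coefs k0 coefs redL (is_weight_wA 0 m1 m2 A).
exists (ln K), m1, m2, A, k; split=> // x.
rewrite pK; last by split; rewrite ?ltNyr ?ltry.
by rewrite -{1}[K]lnK ?posrE// /wA -expRD; congr expR; ring.
Qed.

(** Here a4 = k x^2 and a3 = k (a x + b x^2); the moment equation and the
    vanishing of N''(0) reduce N to a multiple of x^3. *)
Lemma reduced_half_line L p : reduced L 0%:E +oo%E p ->
  exists a b A c k : R, [/\ paramB a b, c != 0, 0 < k,
    same_coefs 1 0 c L (opB a b A) &
    forall x, itv_of 0%:E +oo%E x -> p x = k * wB a b x].
Proof.
move=> redL.
have [s4 s3 s2 s1 a0] := red_form redL.
have g1 := upper_infinite_growth redL; have g2 := upper_infinite_degrees redL.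
have sg := upper_infinite_sign redL.
have [z4 z4' z3] := lower_end_zeros redL; have D := lower_end_double redL.
have E4 : a4 L = ((a4 L)`_0)%:P + (a4 L)`_1 *: 'X + (a4 L)`_2 *: 'X^2.
  by apply: polyE3; lia.
have E3 : a3 L = ((a3 L)`_0)%:P + (a3 L)`_1 *: 'X + (a3 L)`_2 *: 'X^2.
  by apply: polyE3; lia.
have E2 := polyE3 s2; have E1 := polyE2 s1.
have c40 : (a4 L)`_0 = 0 by rewrite -horner_coef0.
have c41 : (a4 L)`_1 = 0 by move: z4'; rewrite E4 !poly.derivE !hornerE /= -E4.
have c30 : (a3 L)`_0 = 0 by rewrite -horner_coef0.
have E4' : a4 L = (a4 L)`_2 *: 'X^2 by rewrite {1}E4 c40 c41 scale0r !add0r.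
have E3' : a3 L = (a3 L)`_1 *: 'X + (a3 L)`_2 *: 'X^2 by rewrite {1}E3 c30 add0r.
have k0 : (a4 L)`_2 != 0.
  by apply/eqP => K; move: a0; rewrite E4' K scale0r eqxx.
have sz4 : size (a4 L) = 3%N by rewrite E4' size_scale// size_polyXn.
have sz3 : size (a3 L) = 3%N by lia.
rewrite !lead_coefE sz4 sz3 /= in sg.
move: E4' E3' E2 E1 k0 sg; clear E4 E3 c40 c41 c30 z4 z4' z3.
move: (a4 L)`_2 (a3 L)`_1 (a3 L)`_2 (a2 L)`_0 (a2 L)`_1 (a2 L)`_2 (a1 L)`_0 (a1 L)`_1.
move=> k h1 h2 e0 e1 e2 f0 f1 E4 E3 E2 E1 k0 sg.
pose a := h1 / k; pose b := h2 / k; pose A := e1 / k.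
pose n0 := 4 * e0 / k + 2 * a - a ^+ 2.
pose n1 := 4 * A - 2 * a * b.
pose n2 := 4 * e2 / k - b ^+ 2.
have h1E : h1 = k * a by rewrite /a; field.
have h2E : h2 = k * b by rewrite /b; field.
have e1E : e1 = k * A by rewrite /A; field.
have e0E : e0 = k / 4 * (n0 - 2 * a + a ^+ 2) by rewrite /n0; field.
have e2E : e2 = k / 4 * (n2 + b ^+ 2) by rewrite /n2; field.
rewrite h1E h2E in E3; rewrite e0E e1E e2E in E2.
have b0 : b < 0.
  have -> : b = k * h2 / k ^+ 2 by rewrite /b; field.
  by rewrite ltr_pdivrMr ?mul0r// exprn_even_gt0.
have A1 : A = n1 / 4 + a * b / 2 by rewrite /n1; field.
clearbody n0 n2 n1 b a A.
have NE : bdpoly L = k ^+ 2 *: (n0 *: 'X^2 + n1 *: 'X^3 + n2 *: 'X^4).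
  apply: poly_ext => x; rewrite /bdpoly E4 E3 E2 A1 !poly.derivE !hornerE /=.
  by field.
have d2k : (a4 L)^`(2).[0] = 2 * k.
  by rewrite E4 !derivnS derivn0 !poly.derivE !hornerE /=; ring.
have d3k : (a3 L)^`().[0] = k * a.
  by rewrite E3 !poly.derivE !hornerE /=; ring.
have d2N : (bdpoly L)^`(2).[0] = 2 * k ^+ 2 * n0.
  by rewrite NE !derivnS derivn0 !poly.derivE !hornerE /=; ring.
rewrite d2k d3k d2N in D.
have [|a2 n00] := D; first by rewrite mulf_neq0.
have n0E : n0 = 0.
  have kk : 2 * k ^+ 2 != 0 by rewrite mulf_neq0 ?expf_neq0.
  by apply: (mulfI kk); rewrite n00 mulr0.
have {}a2 : 2 < a.
  by move: a2; rewrite (_ : k * a / (2 * k) = a / 2); [lra|field].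
have me x : x != 0 -> (n1 * (a - 2) - 8 * f0 / k)
    + (n2 * a + n1 * b - 8 * f1 / k) * x + (n2 * b) * x ^+ 2 = 0.
  move=> x0; have := moment_eq_horner x (red_moment redL).
  rewrite NE E4 E3 E1 n0E !poly.derivE !hornerE /= => E.
  have kx : k ^+ 3 * x ^+ 4 != 0 by rewrite mulf_neq0 ?expf_neq0.
  apply: (mulfI kx); rewrite mulr0.
  by move/eqP: E; rewrite -subr_eq0 => /eqP E; refine (etrans _ E); field.
have [c0 c1 c2] := quadratic_eq0 me.
have n2E : n2 = 0.
  by move/eqP: c2; rewrite mulf_eq0 (lt_eqF b0) orbF => /eqP.
have f0E : f0 = k * n1 * (a - 2) / 8.
  have -> : f0 = 8 * f0 / k * k / 8 by field.
  by move/eqP: c0; rewrite subr_eq0 => /eqP <-; field.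
have f1E : f1 = k * n1 * b / 8.
  have -> : f1 = 8 * f1 / k * k / 8 by field.
  by move/eqP: c1; rewrite n2E mul0r add0r subr_eq0 => /eqP <-; field.
rewrite f0E f1E in E1; rewrite n0E n2E A1 in E2.
have coefs : same_coefs 1 0 k L (opB a b A).
  apply: same_coefs_scale; apply: poly_ext => x.
  - by rewrite E4 /= !hornerE /=.
  - by rewrite E3 /= !hornerE /=; ring.
  - by rewrite E2 A1 /= !hornerE /=; field.
  - by rewrite E1 A1 /= !hornerE /=; field.
have [K K0 pK] := weight_same_coefs k0 coefs redL (is_weight_wB a b A).
by exists a, b, A, k, K; split.
Qed.

(** The double zeros of a4 and the zeros of a3 at both ends leave
    a4 = k (x^2 - 1)^2 and a3 divisible by x^2 - 1; likewise N, which vanishes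
    to the third order at both ends, is a multiple of (x^2 - 1)^3. *)
Lemma reduced_segment L p : reduced L (-1)%:E 1%:E p ->
  exists a b m c k : R, [/\ paramC a b, c != 0, 0 < k,
    same_coefs 1 0 c L (opCm a b m) &
    forall x, itv_of (-1)%:E 1%:E x -> p x = k * wC a b x].
Proof.
move=> redL.
have [s4 s3 s2 s1 a0] := red_form redL.
have [z4 z4' z3] := lower_end_zeros redL; have D := lower_end_double redL.
have [[y4 y4' y3] D'] := upper_end_double redL.
have E4 := polyE5 s4; have E3 := polyE4 s3.
have E2 := polyE3 s2; have E1 := polyE2 s1.
move: E4 E3 E2 E1.
move: (a4 L)`_0 (a4 L)`_1 (a4 L)`_2 (a4 L)`_3 (a4 L)`_4.
move: (a3 L)`_0 (a3 L)`_1 (a3 L)`_2 (a3 L)`_3.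
move: (a2 L)`_0 (a2 L)`_1 (a2 L)`_2 (a1 L)`_0 (a1 L)`_1.
move=> e0 e1 e2 f0 f1 h0 h1 h2 h3 k k1 k2 k3 k4 E4 E3 E2 E1.
rewrite E4 !poly.derivE !hornerE /= in z4 z4' y4 y4'.
rewrite E3 !hornerE /= in z3 y3.
have k1E : k1 = 0 by lra.
have k3E : k3 = 0 by lra.
have k2E : k2 = - 2 * k by lra.
have k4E : k4 = k by lra.
have h2E : h2 = - h0 by lra.
have h3E : h3 = - h1 by lra.
have k0 : k != 0.
  apply/eqP => K; move: a0; rewrite E4 k1E k2E k3E k4E K mulr0 !scale0r !addr0.
  by rewrite eqxx.
pose b := h0 / (2 * k); pose a := h1 / (2 * k) + 2.
have h0E : h0 = 2 * k * b by rewrite /b; field.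
have h1E : h1 = 2 * k * (a - 2) by rewrite /a; field.
pose n0 := e0 / k - b ^+ 2 - (a - 2).
pose n1 := e1 / k - 2 * b * (a - 2) - 2 * b.
pose n2 := e2 / k - (a - 2) ^+ 2 - (a - 2).
have e0E : e0 = k * (n0 + b ^+ 2 + (a - 2)) by rewrite /n0; field.
have e1E : e1 = k * (n1 + 2 * b * (a - 2) + 2 * b) by rewrite /n1; field.
have e2E : e2 = k * (n2 + (a - 2) ^+ 2 + (a - 2)) by rewrite /n2; field.
clearbody n0 n1 n2 a b.
have {}E4 : a4 L = k *: ('X^2 - 1) ^+ 2.
  by apply: poly_ext => x; rewrite E4 k1E k2E k3E k4E !hornerE /=; ring.
have {}E3 : a3 L = (- (2 * k)) *: ((b%:P + (a - 2) *: 'X) * ('X^2 - 1)).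
  by apply: poly_ext => x; rewrite E3 h2E h3E h0E h1E !hornerE /=; ring.
rewrite e0E e1E e2E in E2.
have NE : bdpoly L = (4 * k ^+ 2) *: (('X^2 - 1) ^+ 2 *
    (n0%:P + n1 *: 'X + n2 *: 'X^2)).
  apply: poly_ext => x; rewrite /bdpoly E4 E3 E2 !poly.derivE !hornerE /=.
  by ring.
have d2 (x : R) : x = 1 \/ x = -1 -> (a4 L)^`(2).[x] = 8 * k /\
    (bdpoly L)^`(2).[x] = 32 * k ^+ 2 * (n0 + n1 * x + n2).
  by move=> x2; rewrite NE E4 !derivnS derivn0 !poly.derivE !hornerE /=;
    case: x2 => ->; split; ring.
have d1 (x : R) : x = 1 \/ x = -1 ->
    (a3 L)^`().[x] = - (4 * k) * x * (b + (a - 2) * x).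
  by move=> x2; rewrite E3 !poly.derivE !hornerE /=; case: x2 => ->; ring.
have [dm dNm] := d2 (-1) (or_intror erefl); have [dp dNp] := d2 1 (or_introl erefl).
rewrite dm dNm (d1 (-1) (or_intror erefl)) in D.
rewrite dp dNp (d1 1 (or_introl erefl)) in D'.
have k8 : 8 * k != 0 by rewrite mulf_neq0.
have kk : 32 * k ^+ 2 != 0 by rewrite mulf_neq0 ?expf_neq0.
have [{}D Nm] := D k8; have [{}D' Np] := D' k8.
have {}Nm : n0 + n1 * -1 + n2 = 0 by apply: (mulfI kk); rewrite Nm mulr0.
have {}Np : n0 + n1 * 1 + n2 = 0 by apply: (mulfI kk); rewrite Np mulr0.
have {}D : 1 < (b - a + 2) / 2 by move: D; congr (_ < _); field.
have {}D' : 1 < - (b + a - 2) / 2 by move: D'; congr (_ < _); field.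
have n1E : n1 = 0 by lra.
have n0E : n0 = - n2 by lra.
have {}NE : bdpoly L = (4 * k ^+ 2 * n2) *: ('X^2 - 1) ^+ 3.
  by apply: poly_ext => x; rewrite NE n0E n1E !hornerE /=; ring.
have me (x : R) : k ^+ 2 * (x ^+ 2 - 1) ^+ 4 * (f0 + f1 * x) =
    k ^+ 2 * (x ^+ 2 - 1) ^+ 4 * (- k * n2 * (b + a * x)).
  have := moment_eq_horner x (red_moment redL).
  rewrite NE E4 E3 E1 !poly.derivE !hornerE /= => /eqP.
  rewrite -subr_eq0 => /eqP E; apply/eqP; rewrite -subr_eq0; apply/eqP.
  have n8 : (-8 : R) != 0 by rewrite oppr_eq0.
  by apply: (mulfI n8); rewrite mulr0; refine (etrans _ E); ring.
have f0E : f0 = - k * n2 * b.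
  have nz : k ^+ 2 * (0 ^+ 2 - 1) ^+ 4 != 0 :> R.
    by rewrite mulf_neq0 ?expf_neq0// expr0n /= sub0r oppr_eq0 oner_neq0.
  by have := mulfI nz (me 0); rewrite !mulr0 !addr0.
have f1E : f1 = - k * n2 * a.
  have nz : k ^+ 2 * (2 ^+ 2 - 1) ^+ 4 != 0 :> R.
    by rewrite mulf_neq0 ?expf_neq0// (_ : _ - _ = 3) ?pnatr_eq0//; ring.
  have := mulfI nz (me 2); rewrite f0E => E.
  by lra.
have coefs : same_coefs 1 0 k L (opCm a b n2).
  apply: same_coefs_scale; apply: poly_ext => x.
  - by rewrite E4 /= /a4C !hornerE /=; ring.
  - by rewrite E3 /= /a3C !hornerE /=; ring.
  - by rewrite E2 n0E n1E /= !hornerE /=; ring.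
  - by rewrite E1 f0E f1E /= !hornerE /=; ring.
have [K K0 pK] := weight_same_coefs k0 coefs redL (is_weight_wC a b n2).
by exists a, b, n2, k, K; split=> //; split; lra.
Qed.

End NormalForms.

(** * Finiteness of integrals *)

Section FiniteIntegrals.
Variable R : realType.
Implicit Types (l r : \bar R) (f g G p : R -> R) (L : diffop R) (P : {poly R}).

Lemma continuous_at_mul f g (x : R) : {for x, continuous f} ->
  {for x, continuous g} -> {for x, continuous (fun y => f y * g y)}.
Proof. by move=> cf cg; exact: cvgM. Qed.

Lemma continuous_weight_norm L l r p P : is_weight L l r p ->
  {in itv_of l r, continuous (fun x => p x * `|P.[x]|)}.
Proof.
move=> wp x /set_mem/wp[_ /is_derive_continuous cp].
have cn : {for x, continuous (fun y => `|P.[y]|)}.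
  apply: (continuous_comp (f := horner P)); last exact: norm_continuous.
  exact: continuous_horner.
exact: (continuous_at_mul cp cn).
Qed.

(** The integrals over the segments of an exhaustion are bounded by increments
    of the bounded function G. *)
Lemma integral_lt_pinfty l r f g G (B : R) (a b : nat -> R) :
  (forall n, a n < b n) -> (forall n, itv_of l r (a n)) ->
  (forall n, itv_of l r (b n)) ->
  (forall n, a n.+1 <= a n) -> (forall n, b n <= b n.+1) ->
  (forall x, itv_of l r x -> exists n, a n <= x <= b n) ->
  {in itv_of l r, continuous f} -> {in itv_of l r, continuous g} ->
  (forall x, itv_of l r x -> 0 <= f x <= g x) ->
  (forall x, itv_of l r x -> is_derive x 1 G (g x)) ->
  (forall x, itv_of l r x -> `|G x| <= B) ->
  (\int[@lebesgue_measure R]_(x in itv_of l r) (f x)%:E < +oo)%E.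
Proof.
move=> ab Ia Ib am bm cov cf cg fg dG GB.
pose F n : set R := `[a n, b n]%classic.
have IE : itv_of l r = \bigcup_n F n.
  apply/seteqP; split => x.
    by move=> /cov[n axb]; exists n => //; rewrite /F /= in_itv.
  by move=> [n _]; rewrite /F /= in_itv /=; exact: itv_of_convex (Ia n) (Ib n).
have FI n : F n `<=` itv_of l r by move=> x Fx; rewrite IE; exists n.
have mI : measurable (itv_of l r) by apply: open_measurable; exact: itv_of_open.
have mF n : measurable (F n) by exact: measurable_itv.
have mf (h : R -> R) : {in itv_of l r, continuous h} -> measurable_fun (itv_of l r) (fun x => (h x)%:E).
  by move=> ch; apply/measurable_EFinP; exact: (open_continuous_measurable_fun (@itv_of_open R l r) ch).
have cvg : (\int[@lebesgue_measure R]_(x in F i) (f x)%:E @[i --> \oo]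
    --> \int[@lebesgue_measure R]_(x in itv_of l r) (f x)%:E)%E.
  rewrite IE; apply: ge0_nondecreasing_set_cvg_integral => //.
  - apply/nondecreasing_seqP => n; apply/subsetPset => x; rewrite /F /= !in_itv /=.
    by move=> /andP[ax xb]; rewrite (le_trans (am n) ax) (le_trans xb (bm n)).
  - by move=> n; exact: (measurable_funS mI (FI n) (mf _ cf)).
  - by move=> n x /FI/fg/andP[f0 _]; rewrite lee_fin.
have bound n : (\int[@lebesgue_measure R]_(x in F n) (f x)%:E <= (2 * B)%:E)%E.
  apply: (@le_trans _ _ (\int[@lebesgue_measure R]_(x in F n) (g x)%:E)%E).
    apply: ge0_le_integral => //.
    - exact: mF.
    - by move=> x /FI/fg/andP[f0 _]; rewrite lee_fin.
    - exact: (measurable_funS mI (FI n) (mf _ cf)).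
    - exact: (measurable_funS mI (FI n) (mf _ cg)).
    - by move=> x /FI/fg/andP[_ fgx]; rewrite lee_fin.
  have cG x : itv_of l r x -> {for x, continuous G}.
    by move=> Ix; exact: is_derive_continuous (dG x Ix).
  have sub x : x \in `]a n, b n[ -> itv_of l r x.
    by rewrite in_itv /= => /andP[ax xb]; apply: (FI n); rewrite /F /= in_itv /= (ltW ax) (ltW xb).
  rewrite (@continuous_FTC2 _ g G (a n) (b n) (ab n)).
  - rewrite -EFinB lee_fin; have := GB _ (Ia n); have := GB _ (Ib n).
    by rewrite !ler_norml => /andP[? ?] /andP[? ?]; lra.
  - apply: continuous_in_subspaceT => x /set_mem Fx; apply: cg.
    by apply/mem_set; exact: FI Fx.
  - split.
    + by move=> x /sub Ix; exact: (@ex_derive _ _ _ _ _ _ _ (dG x Ix)).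
    + by apply: cvg_at_right_filter; exact: cG (Ia n).
    + by apply: cvg_at_left_filter; exact: cG (Ib n).
  - by move=> x /sub Ix; exact: derive1_is_derive (dG x Ix).
apply: (@le_lt_trans _ _ (2 * B)%:E); last by rewrite ltry.
rewrite -(cvg_lim _ cvg)//; apply: lime_le; first by apply/cvg_ex; eexists; exact: cvg.
by apply: nearW.
Qed.

(** Each factor X uses up half of the exponential. *)
Lemma poly_exp_bounded P (s : R) : 0 < s ->
  exists2 C, 0 <= C & forall x, 0 <= x -> `|P.[x]| * expR (- (s * x)) <= C.
Proof.
elim/poly_ind: P s => [|P c IH] s s0.
  by exists 0 => // x x0; rewrite horner0 normr0 mul0r.
have s20 : 0 < s / 2 by rewrite divr_gt0.
have [C C0 h] := IH _ s20; exists (C * (2 / s) + `|c|).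
  by rewrite addr_ge0// mulr_ge0// divr_ge0// ltW.
move=> x x0; rewrite hornerD hornerM hornerX hornerC.
have e1 : expR (- (s * x)) <= 1.
  by rewrite -expR0 ler_expR oppr_le0 mulr_ge0// ltW.
apply: le_trans (_ : (`|P.[x]| * x + `|c|) * expR (- (s * x)) <= _).
  rewrite ler_wpM2r ?expR_ge0// (le_trans (ler_normD _ _))//.
  by rewrite normrM (ger0_norm x0).
rewrite mulrDl lerD//; last by rewrite ler_piMr.
have -> : `|P.[x]| * x * expR (- (s * x))
    = (`|P.[x]| * expR (- (s / 2 * x))) * (x * expR (- (s / 2 * x))).
  rewrite (_ : - (s * x) = - (s / 2 * x) + - (s / 2 * x)); last by field.
  by rewrite expRD; ring.
apply: ler_pM; rewrite ?(mulr_ge0 _ (expR_ge0 _))//; first exact: h.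
rewrite expRN ler_pdivrMr ?expR_gt0// mulrC -ler_pdivrMr ?divr_gt0//.
rewrite invf_div mulrC; apply: le_trans (expR_ge1Dx _).
by rewrite lerDr.
Qed.

Lemma poly_segment_bounded P : exists2 C, 0 <= C &
  forall x, -1 <= x <= 1 -> `|P.[x]| <= C.
Proof.
elim/poly_ind: P => [|P c [C C0 h]].
  by exists 0 => // x _; rewrite horner0 normr0.
exists (C + `|c|); first by rewrite addr_ge0.
move=> x xI; rewrite hornerD hornerM hornerX hornerC.
rewrite (le_trans (ler_normD _ _))// lerD2r normrM -[C]mulr1.
by apply: ler_pM => //; [exact: h|rewrite ler_norml].
Qed.

Lemma powR_small (e d : R) : 0 < e -> 0 < d ->
  exists2 y, 0 < y & forall x, 0 < x -> x < y -> x `^ e < d.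
Proof.
move=> e0 d0; exists (d `^ e^-1); first exact: powR_gt0.
move=> x x0 xy; have -> : d = (d `^ e^-1) `^ e.
  by rewrite -powRrM mulVf ?gt_eqF// powRr1// ltW.
by apply: gt0_ltr_powR => //; rewrite nnegrE ?powR_ge0 ?(ltW x0).
Qed.

End FiniteIntegrals.

(** * The model operators on the line *)

Section NormalFormsLine.
Variable R : realType.
Implicit Types (P : {poly R}) (m x A : R) (f : R -> R).

Lemma poly_exp_norm_bounded P : exists2 C, 0 <= C &
  forall x, `|P.[x]| * expR (- `|x|) <= C.
Proof.
have [C1 C10 h1] := poly_exp_bounded P ltr01.
have [C2 C20 h2] := poly_exp_bounded (P \Po affX (-1) 0) ltr01.
exists (C1 + C2); first exact: addr_ge0.
move=> x; have [x0|x0] := leP 0 x.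
- have := h1 x x0; rewrite mul1r (ger0_norm x0) => h.
  by apply: le_trans h _; rewrite lerDl.
- have := h2 (- x); rewrite oppr_ge0 (ltW x0) => /(_ isT).
  rewrite horner_affX mulN1r opprK addr0 mul1r opprK (ltr0_norm x0) opprK => h.
  by apply: le_trans h _; rewrite lerDr.
Qed.

(** Completing the square bounds the weight by a multiple of exp (- |x|). *)
Lemma wA_bounded (m0 m1 m2 : R) P : m2 != 0 -> exists2 C, 0 <= C &
  forall x, `|P.[x]| * wA m0 m1 m2 x * (1 + x ^+ 2) <= C.
Proof.
move=> m20; have s0 : 0 < m2 ^+ 2 by rewrite exprn_even_gt0.
have [C C0 h] := poly_exp_norm_bounded (P * (1 + 'X^2)).
pose t := `|m1| + 1; pose d := t ^+ 2 / (4 * m2 ^+ 2) + m0.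
have wle x : wA m0 m1 m2 x <= expR d * expR (- `|x|).
  rewrite -expRD ler_expR /d.
  have e1 : m1 * x <= `|m1| * `|x| by rewrite -normrM ler_norm.
  have e2 : 0 <= m2 ^+ 2 * (`|x| - t / (2 * m2 ^+ 2)) ^+ 2.
    by rewrite mulr_ge0 ?sqr_ge0.
  have e3 : m2 ^+ 2 * (`|x| - t / (2 * m2 ^+ 2)) ^+ 2 =
      m2 ^+ 2 * x ^+ 2 - t * `|x| + t ^+ 2 / (4 * m2 ^+ 2).
    by rewrite -[x ^+ 2]real_normK ?num_real//; field.
  rewrite e3 in e2; have e4 : t * `|x| = `|m1| * `|x| + `|x| by rewrite /t; ring.
  by lra.
exists (C * expR d); first by rewrite mulr_ge0 ?expR_ge0.
move=> x; have x2 : 0 <= 1 + x ^+ 2 by rewrite addr_ge0 ?sqr_ge0.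
apply: le_trans (_ : `|P.[x]| * (expR d * expR (- `|x|)) * (1 + x ^+ 2) <= _).
  by rewrite ler_wpM2r// ler_wpM2l.
have := h x; rewrite hornerM hornerD hornerXn hornerC normrM (ger0_norm x2) => hx.
have -> : `|P.[x]| * (expR d * expR (- `|x|)) * (1 + x ^+ 2)
   = `|P.[x]| * (1 + x ^+ 2) * expR (- `|x|) * expR d by ring.
by rewrite ler_wpM2r ?expR_ge0.
Qed.

Lemma ends0_line f C : (forall x, `|f x| * (1 + x ^+ 2) <= C) ->
  ends0 -oo%E +oo%E f.
Proof.
move=> fC.
have key e x : 0 < e -> `|C / e| + 1 < `|x| -> `|f x| < e.
  move=> e0 xb; rewrite ltNge; apply/negP => ef.
  have x2 : 0 < 1 + x ^+ 2 by rewrite ltr_pwDl// sqr_ge0.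
  have : e * (1 + x ^+ 2) <= C.
    by apply: le_trans (fC x); rewrite ler_wpM2r// ltW.
  rewrite mulrC -ler_pdivlMr// => h.
  have := ler_norm (C / e); have := normr_ge0 (C / e).
  have : `|x| ^+ 2 = x ^+ 2 by rewrite real_normK ?num_real.
  by nra.
split=> e e0.
- exists (- (`|C / e| + 1)); first by split; rewrite ?ltNyr ?ltry.
  move=> x _ xy; apply: key => //.
  have x0 : x < 0 by have := normr_ge0 (C / e); lra.
  by rewrite (ltr0_norm x0); lra.
- exists (`|C / e| + 1); first by split; rewrite ?ltNyr ?ltry.
  move=> x _ xy; apply: key => //.
  have x0 : 0 < x by have := normr_ge0 (C / e); lra.
  by rewrite (gtr0_norm x0).
Qed.

Lemma ends0_wA (m0 m1 m2 : R) P f : m2 != 0 ->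
  (forall x, f x = P.[x] * wA m0 m1 m2 x) -> ends0 -oo%E +oo%E f.
Proof.
move=> m20 fE; have [C C0 h] := wA_bounded m0 m1 P m20.
apply: (@ends0_line _ C) => x; rewrite fE normrM.
by rewrite (ger0_norm (expR_ge0 _)).
Qed.

Lemma bdpoly_opA (m1 m2 A : R) :
  bdpoly (opA m1 m2 A) = (4 * (A - m1 ^+ 2 + 2 * m2 ^+ 2))%:P.
Proof.
apply: poly_ext => x; rewrite /bdpoly /opA /= !poly.derivE !hornerE /=.
by ring.
Qed.

Lemma size_leq_coef P n : (forall i, (n <= i)%N -> P`_i = 0) -> (size P <= n)%N.
Proof. by move=> h; apply/leq_sizeP. Qed.

Lemma reduced_opA (m0 m1 m2 A : R) : m2 != 0 ->
  reduced (opA m1 m2 A) -oo%E +oo%E (wA m0 m1 m2).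
Proof.
move=> m20; split.
- split=> /=.
  + by rewrite size_poly1.
  + apply: size_leq_coef => -[|[|[|[|i]]]]//= _.
    by rewrite !(coefZ, coefB, coefC, coefX)//= mulr0 subr0 mulr0.
  + apply: size_leq_coef => -[|[|[|i]]]//= _.
    by rewrite !(coefZ, coefB, coefD, coefC, coefX, coefXn)//= !mulr0 subr0 addr0.
  + apply: size_leq_coef => -[|[|i]]//= _.
    by rewrite !(coefZ, coefB, coefC, coefX)//= mulr0 subr0 mulr0.
  + exact: oner_neq0.
- by split=> // x _ /=; rewrite /root hornerC oner_neq0.
- exact: is_weight_wA.
- have oo : ((-oo : \bar R) < +oo)%E by [].
  apply/(moment_eqP _ oo) => x _; rewrite bdpoly_opA /= !poly.derivE !hornerE /=.
  by ring.
- by apply: (@ends0_wA m0 m1 m2 1) => // x /=; rewrite hornerC.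
- by apply: (@ends0_wA m0 m1 m2 (a3 (opA m1 m2 A))).
- apply: (@ends0_wA m0 m1 m2 (A - m1 ^+ 2 + 2 * m2 ^+ 2)%:P) => // x.
  by rewrite /bdterm bdpoly_opA /= !hornerC; field.
- move=> u; have [C C0 h] := wA_bounded m0 m1 u m20.
  pose Q : {poly R} := 1 + 'X^2.
  have QE x : Q.[x] = 1 + x ^+ 2 by rewrite /Q hornerD hornerXn hornerC.
  have Q0 x : 0 < Q.[x] by rewrite QE ltr_pwDl// sqr_ge0.
  apply: (@integral_lt_pinfty _ _ _ _ (fun x => C * (Q.[x])^-1)
    (fun x => C * atan x) (C * (pi / 2))
    (fun n => - n.+1%:R) (fun n => n.+1%:R)).
  + by move=> n; apply: (@lt_trans _ _ 0); rewrite ?oppr_lt0 ltr0Sn.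
  + by move=> n; split; rewrite ?ltNyr ?ltry.
  + by move=> n; split; rewrite ?ltNyr ?ltry.
  + by move=> n; rewrite lerN2 ler_nat.
  + by move=> n; rewrite ler_nat.
  + move=> x _; exists (Num.bound `|x|).
    have := archi_boundP (normr_ge0 x); rewrite ltr_norml => /andP[h1 h2].
    by rewrite -natr1; apply/andP; split; lra.
  + exact: continuous_weight_norm (is_weight_wA m0 m1 m2 A).
  + move=> x _; have Qx : Q.[x] != 0 by rewrite gt_eqF.
    exact: is_derive_continuous (is_derive_cmul C
      (is_derive_inv (f := horner Q) Qx (is_derive_horner Q x))).
  + move=> x _; rewrite mulr_ge0 ?expR_ge0//=.
    by rewrite ler_pdivlMr// QE; have := h x; rewrite [`|_| * wA _ _ _ _]mulrC.
  + by move=> x _; rewrite QE; apply: is_derive_cmul.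
  + move=> x _; rewrite normrM (ger0_norm C0) ler_wpM2l// ler_norml.
    by rewrite (ltW (atan_gtNpi2 x)) (ltW (atan_ltpi2 x)).
Qed.

End NormalFormsLine.

(** * The model operators on the half-line *)

Section NormalFormHalfLine.
Variable R : realType.
Variables (a b A : R).
Hypothesis ab : paramB a b.
Implicit Types (P : {poly R}) (x : R) (f : R -> R).

Let a_gt2 : 2 < a. Proof. by case: ab. Qed.
Let b_lt0 : b < 0. Proof. by case: ab. Qed.
Let e := a / 2 - 2.
Let e1 : 0 < e + 1. Proof. by have := a_gt2; rewrite /e; lra. Qed.

Let h x := x * (1 + x)^-1.

Let hx x : 0 < x -> 0 < h x.
Proof. by move=> x0; rewrite /h divr_gt0// addr_gt0. Qed.

Let hE x : 0 < x -> x = h x * (1 + x).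
Proof. by move=> x0; rewrite /h divfK// gt_eqF// addr_gt0. Qed.

Let hle1 x : 0 < x -> h x `^ (e + 1) <= 1.
Proof.
move=> x0; apply: (@le_trans _ _ (1 `^ (e + 1))); last by rewrite powR1.
apply: ge0_ler_powR; rewrite ?nnegrE ?(ltW e1) ?(ltW (hx x0)) ?ler01//.
by rewrite /h ler_pdivrMr ?addr_gt0// mul1r lerDr.
Qed.

(** The substitution h = x / (1 + x) turns the bound into the integrable
    function h ^ e h' on a bounded interval. *)
Lemma wB_bounded P : exists2 C, 0 <= C & forall x, 0 < x ->
  `|P.[x]| * wB a b x <= C * (h x `^ e * ((1 + x) ^+ 2)^-1).
Proof.
have [n en] : exists n : nat, e + 2 <= n%:R.
  exists (Num.bound `|e + 2|); apply: ltW.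
  exact: (le_lt_trans (ler_norm _) (archi_boundP (normr_ge0 _))).
have s0 : 0 < - (b / 2) by have := b_lt0; lra.
have [C C0 hC] := poly_exp_bounded (P * (1 + 'X) ^+ n) s0.
exists C => // x x0.
have x1 : 0 < 1 + x by rewrite addr_gt0.
have := hC x (ltW x0); rewrite hornerM horner_exp hornerD hornerX hornerC.
rewrite normrM [`|_ ^+ n|]gtr0_norm ?exprn_gt0// => le.
have -> : wB a b x = h x `^ e * (1 + x) `^ e * expR (- (- (b / 2) * x)).
  rewrite -powRM ?(ltW (hx x0)) ?ltW// -hE// /wB (gtr0_norm x0) -/e.
  by rewrite mulNr opprK.
have pE : (1 + x) `^ (e + 2) = (1 + x) `^ e * (1 + x) ^+ 2.
  rewrite powRD; last by apply/implyP => _; rewrite gt_eqF.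
  by rewrite (powR_mulrn 2)// ltW.
have -> : `|P.[x]| * (h x `^ e * (1 + x) `^ e * expR (- (- (b / 2) * x)))
    = (`|P.[x]| * (1 + x) `^ (e + 2) * expR (- (- (b / 2) * x)))
      * (h x `^ e * ((1 + x) ^+ 2)^-1).
  by rewrite pE; field; rewrite gt_eqF.
apply: ler_wpM2r.
  by rewrite mulr_ge0 ?powR_ge0// invr_ge0 exprn_ge0// ltW.
apply: le_trans le; rewrite ler_wpM2r ?expR_ge0// ler_wpM2l//.
by rewrite -(powR_mulrn n (ltW x1)) ler_powR// lerDl ltW.
Qed.

Lemma ends0_wB P f :
  (forall x, itv_of 0%:E +oo%E x -> f x = P.[x] * (x * wB a b x)) ->
  ends0 0%:E +oo%E f.
Proof.
move=> fE; have [C C0 hC] := wB_bounded P.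
have fle x : 0 < x -> `|f x| <= C * (h x `^ (e + 1) * (1 + x)^-1).
  move=> x0; have x1 : 0 < 1 + x by rewrite addr_gt0.
  have w0 : 0 <= wB a b x by rewrite mulr_ge0 ?powR_ge0 ?expR_ge0.
  rewrite fE; last by split; rewrite ?lte_fin ?ltry.
  rewrite normrM [`|x * _|]normrM (ger0_norm w0) (gtr0_norm x0).
  have -> : `|P.[x]| * (x * wB a b x) = `|P.[x]| * wB a b x * x by ring.
  have -> : C * (h x `^ (e + 1) * (1 + x)^-1)
      = C * (h x `^ e * ((1 + x) ^+ 2)^-1) * x.
    rewrite powRD; last by apply/implyP => _; rewrite gt_eqF ?hx.
    rewrite (powRr1 (ltW (hx x0))) {2}/h; field; exact: lt0r_neq0.
  by rewrite ler_wpM2r ?(ltW x0)// hC.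
have C1 : 0 < C + 1 by rewrite ltr_wpDl.
have lt1 d t : 0 < d -> 0 <= t -> t < d / (C + 1) -> C * t < d.
  move=> d0 t0; rewrite ltr_pdivlMr// mulrDr mulr1 => h'.
  by apply: le_lt_trans h'; rewrite mulrC lerDl.
split=> d d0.
- have [|y y0 hy] := powR_small (d := d / (C + 1)) e1; first by rewrite divr_gt0.
  exists y; first by split; rewrite ?lte_fin ?ltry.
  move=> x [x0 _] xy; rewrite lte_fin in x0.
  apply: le_lt_trans (fle x x0) _; apply: lt1 => //.
    by rewrite mulr_ge0 ?powR_ge0// invr_ge0 addr_ge0 ?ltW.
  apply: le_lt_trans (hy x x0 xy).
  have x1 : 0 < 1 + x by rewrite addr_gt0.
  have hlex : h x <= x by rewrite /h ler_pdivrMr// ler_peMr ?ltW// ltrDl.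
  apply: le_trans (_ : h x `^ (e + 1) <= _).
    by rewrite ler_piMr ?powR_ge0// invf_le1// lerDl ltW.
  by apply: ge0_ler_powR; rewrite ?nnegrE ?(ltW e1) ?(ltW (hx x0)) ?(ltW x0).
- have dC : 0 < (C + 1) / d by rewrite divr_gt0.
  exists ((C + 1) / d); first by split; rewrite ?lte_fin ?ltry.
  move=> x [x0 _] xy; rewrite lte_fin in x0.
  have x1 : 0 < 1 + x by rewrite addr_gt0.
  apply: le_lt_trans (fle x x0) _; apply: lt1 => //.
    by rewrite mulr_ge0 ?powR_ge0// invr_ge0 addr_ge0 ?ltW.
  apply: le_lt_trans (_ : (1 + x)^-1 < _).
    rewrite ler_piMl ?invr_ge0 ?(ltW x1)//.
    exact: hle1.
  have hh : (1 + x)^-1 < ((C + 1) / d)^-1.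
    by rewrite ltf_pV2 ?posrE// (lt_trans xy)// ltrDr.
  by rewrite invf_div in hh.
Qed.

Lemma bdpoly_opB : bdpoly (opB a b A) = (4 * A - 2 * a * b) *: 'X^3.
Proof.
apply: poly_ext => x; rewrite /bdpoly /opB /= !poly.derivE !hornerE /=.
by field.
Qed.

Lemma reduced_opB : reduced (opB a b A) 0%:E +oo%E (wB a b).
Proof.
have a40 x : itv_of 0%:E +oo%E x -> (a4 (opB a b A)).[x] != 0.
  by move=> [x0 _]; rewrite hornerXn expf_neq0// gt_eqF// -lte_fin.
split.
- split=> /=.
  + by rewrite size_polyXn.
  + apply: size_leq_coef => -[|[|[|[|i]]]]//= _.
    by rewrite coefXM /= coefD coefC coefZ coefX /= mulr0 addr0.
  + apply: size_leq_coef => -[|[|[|i]]]//= _.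
    by rewrite coefZ coefD coefC coefXM /= coefD coefC coefZ coefX /= !(mulr0, addr0).
  + apply: size_leq_coef => -[|[|i]]//= _.
    by rewrite coefZ coefD coefC coefZ coefX /= !(mulr0, addr0).
  + by rewrite -size_poly_gt0 size_polyXn.
- split=> //; first by rewrite ltry.
  by move=> _ [<-]; rewrite /root hornerXn expr0n.
- exact: is_weight_wB.
- have oo : (0%:E < +oo :> \bar R)%E by rewrite ltry.
  apply/(moment_eqP _ oo) => x _; rewrite bdpoly_opB /= !poly.derivE !hornerE /=.
  by field.
- by apply: (@ends0_wB 'X) => x _ /=; rewrite hornerXn hornerX; ring.
- by apply: (@ends0_wB (a%:P + b *: 'X)) => x _ /=; rewrite !hornerE /=; ring.
- apply: (@ends0_wB (A - a * b / 2)%:P) => x /a40/= xn0.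
  rewrite /bdterm bdpoly_opB /= hornerZ !hornerXn hornerC.
  rewrite hornerXn expf_eq0 /= in xn0.
  by field.
- move=> u; have [C C0 hC] := wB_bounded u.
  pose Q : {poly R} := (1 + 'X) ^+ 2.
  have QE x : Q.[x] = (1 + x) ^+ 2.
    by rewrite /Q horner_exp hornerD hornerX hornerC.
  have dh x : 0 < x -> is_derive x 1 h (Q.[x])^-1.
    move=> x0; have x1 : 1 + x != 0 by rewrite gt_eqF// addr_gt0.
    have d1 : is_derive x 1 (fun y : R => 1 + y) (0 + 1) by apply: is_derive_add.
    have dm := is_derive_mul (is_derive_id x 1)
      (is_derive_inv (f := fun y => 1 + y) x1 d1).
    by apply: (is_derive_eq dm); rewrite QE; field.
  have dhp x (d : R) : 0 < x ->
      is_derive x 1 (fun y => h y `^ d) (d * h x `^ (d - 1) * (Q.[x])^-1).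
    move=> x0; apply: (is_derive1_comp (f := fun t => t `^ d) (g := h)).
      exact: is_derive1_powR (hx x0).
    exact: dh.
  apply: (@integral_lt_pinfty _ _ _ _ (fun x => C * (h x `^ e * (Q.[x])^-1))
    (fun x => (C / (e + 1)) * h x `^ (e + 1)) (C / (e + 1))
    (fun n => n.+2%:R^-1) (fun n => n.+2%:R)).
  + move=> n; apply: (@lt_le_trans _ _ 1); first by rewrite invf_lt1 ?ltr1n.
    by rewrite ler1n.
  + by move=> n; split; rewrite ?lte_fin ?ltry ?invr_gt0 ?ltr0Sn.
  + by move=> n; split; rewrite ?lte_fin ?ltry ?ltr0Sn.
  + by move=> n; rewrite lef_pV2 ?posrE ?ltr0Sn// ler_nat.
  + by move=> n; rewrite ler_nat.
  + move=> x [x0 _]; rewrite lte_fin in x0; exists (Num.bound (x + x^-1)).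
    have xi : 0 < x^-1 by rewrite invr_gt0.
    have := archi_boundP (ltW (addr_gt0 x0 xi)); set n := Num.bound _ => hn.
    have n2 : (n%:R : R) <= n.+2%:R by rewrite ler_nat; lia.
    apply/andP; split; last by lra.
    by rewrite -[x]invrK lef_pV2 ?posrE ?ltr0Sn//; lra.
  + exact: continuous_weight_norm (is_weight_wB a b A).
  + move=> x /set_mem[x0 _]; rewrite lte_fin in x0.
    have Qx : Q.[x] != 0 by rewrite QE expf_neq0// gt_eqF// addr_gt0.
    exact: is_derive_continuous (is_derive_cmul C (is_derive_mul (dhp x e x0)
      (is_derive_inv (f := horner Q) Qx (is_derive_horner Q x)))).
  + move=> x [x0 _]; rewrite lte_fin in x0.
    have w0 : 0 <= wB a b x by rewrite mulr_ge0 ?powR_ge0 ?expR_ge0.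
    by rewrite mulr_ge0//= mulrC QE; exact: hC.
  + move=> x [x0 _]; rewrite lte_fin in x0.
    apply: (is_derive_eq (is_derive_cmul _ (dhp x (e + 1) x0))).
    have Qx : Q.[x] != 0 by rewrite QE expf_neq0// gt_eqF// addr_gt0.
    by rewrite addrK; field; rewrite Qx gt_eqF.
  + move=> x [x0 _]; rewrite lte_fin in x0.
    have Ce : 0 <= C / (e + 1) by rewrite divr_ge0// ltW.
    rewrite normrM (ger0_norm Ce) ger0_norm ?powR_ge0// ler_piMr//.
    exact: hle1.
Qed.

End NormalFormHalfLine.

(** * The model operators on the segment *)

Lemma opCm_monomials (R : realType) (a b m : R) :
  [/\ a4 (opCm a b m) = 1%:P + (-2) *: 'X^2 + 1 *: 'X^4,
      a3 (opCm a b m) = (2 * b)%:P + (2 * (a - 2)) *: 'X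
        + (- (2 * b)) *: 'X^2 + (- (2 * (a - 2))) *: 'X^3,
      a2 (opCm a b m) = (b ^+ 2 + (a - 2) - m)%:P
        + (2 * b * (a - 2) + 2 * b) *: 'X + ((a - 2) ^+ 2 + (a - 2) + m) *: 'X^2 &
      a1 (opCm a b m) = (- m * b)%:P + (- m * a) *: 'X].
Proof.
by split; apply: poly_ext => x; rewrite /= /a4C /a3C !hornerE /=; ring.
Qed.

Section NormalFormSegment.
Variable R : realType.
Variables (a b m : R).
Hypothesis ab : paramC a b.
Implicit Types (P : {poly R}) (x : R) (f : R -> R).

Let e1 := (- 2 - a - b) / 2.
Let e2 := (- 2 - a + b) / 2.
Let d1 : 0 < e1 + 1. Proof. by have [? ?] := ab; rewrite /e1; lra. Qed.
Let d2 : 0 < e2 + 1. Proof. by have [? ?] := ab; rewrite /e2; lra. Qed.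

Let wCE x : -1 < x < 1 ->
  (1 - x ^+ 2) * wC a b x = (1 - x) `^ (e1 + 1) * (1 + x) `^ (e2 + 1).
Proof.
move=> /andP[x0 x1].
have xm : 0 < 1 - x by lra.
have xp : 0 < 1 + x by lra.
rewrite (powRD (x := 1 - x)); last by apply/implyP => _; rewrite gt_eqF.
rewrite (powRD (x := 1 + x)); last by apply/implyP => _; rewrite gt_eqF.
by rewrite (powRr1 (ltW xm)) (powRr1 (ltW xp)) /wC -/e1 -/e2; ring.
Qed.

Let pow2 x d : 0 < d -> 0 <= x <= 2 -> x `^ d <= 2 `^ d.
Proof. by move=> d0 /andP[x0 x2]; apply: ge0_ler_powR; rewrite ?nnegrE ?(ltW d0). Qed.

Lemma ends0_wC P f :
  (forall x, itv_of (-1)%:E 1%:E x -> f x = P.[x] * ((1 - x ^+ 2) * wC a b x)) ->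
  ends0 (-1)%:E 1%:E f.
Proof.
move=> fE; have [C C0 hC] := poly_segment_bounded P.
pose D := C * (2 `^ (e1 + 1) + 2 `^ (e2 + 1)) + 1.
have p1 : 0 <= 2 `^ (e1 + 1) := powR_ge0 _ _.
have p2 : 0 <= 2 `^ (e2 + 1) := powR_ge0 _ _.
have D0 : 0 < D by rewrite /D ltr_wpDl// mulr_ge0// addr_ge0.
have fle x : -1 < x < 1 ->
    `|f x| <= D * (1 - x) `^ (e1 + 1) /\ `|f x| <= D * (1 + x) `^ (e2 + 1).
  move=> xI; have /andP[x0 x1] := xI.
  have Ix : itv_of (-1)%:E 1%:E x by split; rewrite lte_fin.
  rewrite fE// wCE// normrM [`|_ `^ _ * _|]ger0_norm ?mulr_ge0 ?powR_ge0//.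
  have P1 : `|P.[x]| <= C by apply: hC; rewrite !ltW.
  have q1 : (1 - x) `^ (e1 + 1) <= 2 `^ (e1 + 1) by apply: pow2 => //; lra.
  have q2 : (1 + x) `^ (e2 + 1) <= 2 `^ (e2 + 1) by apply: pow2 => //; lra.
  split.
  - rewrite mulrCA [leRHS]mulrC; apply: ler_wpM2l; first exact: powR_ge0.
    apply: le_trans (_ : C * 2 `^ (e2 + 1) <= _).
      by apply: ler_pM => //; exact: powR_ge0.
    have := mulr_ge0 C0 p1; rewrite /D; lra.
  - rewrite mulrA; apply: ler_wpM2r; first exact: powR_ge0.
    apply: le_trans (_ : C * 2 `^ (e1 + 1) <= _).
      by apply: ler_pM => //; exact: powR_ge0.
    have := mulr_ge0 C0 p2; rewrite /D; lra.
split=> d d0.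
- have [|y y0 hy] := powR_small (d := d / D) d2; first by rewrite divr_gt0.
  exists (Num.min 0 (y - 1)).
    split; first by rewrite lte_fin lt_min; apply/andP; split; lra.
    by rewrite lte_fin gt_min ltr01.
  move=> x [x0 x1]; rewrite !lte_fin in x0 x1; rewrite lt_min => /andP[_ xy].
  have [|_ le] := fle x; first by rewrite x0.
  apply: le_lt_trans le _; rewrite mulrC -ltr_pdivlMr//; apply: hy; lra.
- have [|y y0 hy] := powR_small (d := d / D) d1; first by rewrite divr_gt0.
  exists (Num.max 0 (1 - y)).
    split; last by rewrite lte_fin gt_max; apply/andP; split; lra.
    by rewrite lte_fin lt_max ltrN10.
  move=> x [x0 x1]; rewrite !lte_fin in x0 x1; rewrite gt_max => /andP[_ xy].
  have [|le _] := fle x; first by rewrite x0.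
  apply: le_lt_trans le _; rewrite mulrC -ltr_pdivlMr//; apply: hy; lra.
Qed.

(** Each factor of the weight is bounded on the half of the segment where the
    other one may blow up. *)
Lemma wC_le_sum : exists2 C, 0 <= C & forall x, -1 < x < 1 ->
  wC a b x <= C * ((1 - x) `^ e1 + (1 + x) `^ e2).
Proof.
have bd e : exists2 C, 0 <= C & forall x, 1 <= x <= 2 -> x `^ e <= C.
  exists (2 `^ `|e|); first exact: powR_ge0.
  move=> x /andP[x1 x2]; apply: le_trans (_ : x `^ `|e| <= _).
    by rewrite ler_powR// ler_norm.
  by apply: ge0_ler_powR; rewrite ?nnegrE//; lra.
have [C1 C10 h1] := bd e1; have [C2 C20 h2] := bd e2.
exists (C1 + C2); first exact: addr_ge0.
move=> x /andP[x0 x1]; rewrite /wC -/e1 -/e2.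
have p1 := powR_ge0 (1 - x) e1; have p2 := powR_ge0 (1 + x) e2.
have [xs|xs] := leP 0 x.
- have q : (1 + x) `^ e2 <= C2 by apply: h2; lra.
  have := ler_wpM2l p1 q; have := mulr_ge0 C10 p1; have := mulr_ge0 C10 p2.
  have := mulr_ge0 C20 p2; lra.
- have q : (1 - x) `^ e1 <= C1 by apply: h1; lra.
  have := ler_wpM2r p2 q; have := mulr_ge0 C10 p1; have := mulr_ge0 C20 p1.
  have := mulr_ge0 C20 p2; lra.
Qed.

Lemma bdpoly_opCm : bdpoly (opCm a b m) = (4 * m) *: ('X^2 - 1) ^+ 3.
Proof.
apply: poly_ext => x; rewrite /bdpoly /opCm /a4C /a3C /= !poly.derivE !hornerE /=.
by ring.
Qed.

Lemma reduced_opCm : reduced (opCm a b m) (-1)%:E 1%:E (wC a b).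
Proof.
have a4E x : (a4 (opCm a b m)).[x] = (1 - x ^+ 2) ^+ 2.
  by rewrite /= /a4C !hornerE.
have a40 x : itv_of (-1)%:E 1%:E x -> (a4 (opCm a b m)).[x] != 0.
  move=> [x0 x1]; rewrite !lte_fin in x0 x1; rewrite a4E expf_neq0// gt_eqF//.
  by rewrite (_ : _ - _ = (1 - x) * (1 + x)); [rewrite mulr_gt0//; lra|ring].
split.
- have [E4 E3 E2 E1] := opCm_monomials a b m.
  have cf := (coefD, coefZ, coefC, coefX, coefXn).
  split.
  + rewrite E4; apply: size_leq_coef => -[|[|[|[|[|i]]]]]//= _.
    by rewrite !cf /= !(mulr0, addr0).
  + rewrite E3; apply: size_leq_coef => -[|[|[|[|i]]]]//= _.
    by rewrite !cf /= !(mulr0, addr0).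
  + rewrite E2; apply: size_leq_coef => -[|[|[|i]]]//= _.
    by rewrite !cf /= !(mulr0, addr0).
  + rewrite E1; apply: size_leq_coef => -[|[|i]]//= _.
    by rewrite !cf /= !(mulr0, addr0).
  + apply/eqP => /(congr1 (fun P => P.[0])); rewrite a4E horner0 expr0n /= subr0.
    by rewrite expr1n => /eqP; rewrite oner_eq0.
- split; first by rewrite lte_fin; lra.
  + exact: a40.
  + by move=> _ [<-]; rewrite /root a4E sqrrN expr1n subrr expr0n.
  + by move=> _ [<-]; rewrite /root a4E expr1n subrr expr0n.
- exact: is_weight_wC.
- have oo : ((-1)%:E < 1%:E :> \bar R)%E by rewrite lte_fin; lra.
  apply/(moment_eqP _ oo) => x _.
  rewrite bdpoly_opCm /= /a4C /a3C !poly.derivE !hornerE /=.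
  by ring.
- by apply: (@ends0_wC (1 - 'X^2)) => x _; rewrite a4E !hornerE /=; ring.
- apply: (@ends0_wC (2 *: (b%:P + (a - 2) *: 'X))) => x _.
  by rewrite /= /a3C !hornerE /=; ring.
- apply: (@ends0_wC (- m)%:P) => x /a40; rewrite /bdterm bdpoly_opCm a4E => xn0.
  rewrite !hornerE /=.
  have xn : 1 - x ^+ 2 != 0 by move: xn0; rewrite expf_eq0.
  by field.
- move=> u; have [C C0 hC] := wC_le_sum; have [K K0 hK] := poly_segment_bounded u.
  have pos x : -1 < x -> x < 1 -> 0 < 1 - x /\ 0 < 1 + x by move=> ? ?; split; lra.
  have dm x (d : R) : x < 1 ->
      is_derive x 1 (fun y => (1 - y) `^ d) (d * (1 - x) `^ (d - 1) * (0 - 1)).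
    move=> x1; have xm : 0 < 1 - x by lra.
    have dl : is_derive x 1 (fun y : R => 1 - y) (0 - 1).
      by apply: is_derive_add; exact: is_derive_opp.
    exact: (is_derive1_comp (f := fun y => y `^ d) (g := fun y => 1 - y)
      (is_derive1_powR d xm) dl).
  have dp x (d : R) : -1 < x ->
      is_derive x 1 (fun y => (1 + y) `^ d) (d * (1 + x) `^ (d - 1) * (0 + 1)).
    move=> x1; have xp : 0 < 1 + x by lra.
    have dl : is_derive x 1 (fun y : R => 1 + y) (0 + 1).
      by apply: is_derive_add.
    exact: (is_derive1_comp (f := fun y => y `^ d) (g := fun y => 1 + y)
      (is_derive1_powR d xp) dl).
  have [s [s0 s2 sd sx]] : exists s : nat -> R, [/\ forall n, 0 < s n,
      forall n, s n <= 2^-1, forall n, s n.+1 <= s n &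
      forall t, 0 < t -> exists n, s n <= t].
    exists (fun n => n.+2%:R^-1); split.
    - by move=> n; rewrite invr_gt0 ltr0Sn.
    - by move=> n; rewrite lef_pV2 ?posrE ?ltr0Sn// ler_nat.
    - by move=> n; rewrite lef_pV2 ?posrE ?ltr0Sn// ler_nat.
    - move=> t t0; exists (Num.bound t^-1).
      have it : 0 < t^-1 by rewrite invr_gt0.
      have := archi_boundP (ltW it); set n := Num.bound _ => hn.
      rewrite -[t]invrK lef_pV2 ?posrE ?ltr0Sn//.
      by apply: le_trans (ltW hn) _; rewrite ler_nat; lia.
  pose D1 := (e1 + 1)^-1; pose D2 := (e2 + 1)^-1.
  have D10 : 0 < D1 by rewrite invr_gt0.
  have D20 : 0 < D2 by rewrite invr_gt0.
  apply: (@integral_lt_pinfty _ _ _ _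
    (fun x => K * C * ((1 - x) `^ e1 + (1 + x) `^ e2))
    (fun x => K * C * (- (D1 * (1 - x) `^ (e1 + 1)) + D2 * (1 + x) `^ (e2 + 1)))
    (K * C * (D1 * 2 `^ (e1 + 1) + D2 * 2 `^ (e2 + 1)))
    (fun n => -1 + s n) (fun n => 1 - s n)).
  + by move=> n; have := s0 n; have := s2 n; lra.
  + by move=> n; have := s0 n; have := s2 n; split; rewrite lte_fin; lra.
  + by move=> n; have := s0 n; have := s2 n; split; rewrite lte_fin; lra.
  + by move=> n; have := sd n; lra.
  + by move=> n; have := sd n; lra.
  + move=> x [x0 x1]; rewrite !lte_fin in x0 x1; have [xm xp] := pos x x0 x1.
    have [|n] := sx (Num.min (1 - x) (1 + x)); first by rewrite lt_min xm.
    rewrite le_min => /andP[h1 h2]; exists n.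
    by apply/andP; split; lra.
  + exact: continuous_weight_norm (is_weight_wC a b m).
  + move=> x /set_mem[x0 x1]; rewrite !lte_fin in x0 x1.
    exact: is_derive_continuous (is_derive_cmul (K * C)
      (is_derive_add (dm x e1 x1) (dp x e2 x0))).
  + move=> x [x0 x1]; rewrite !lte_fin in x0 x1.
    have w0 : 0 <= wC a b x by rewrite mulr_ge0 ?powR_ge0.
    rewrite mulr_ge0//= mulrC -mulrA; apply: ler_pM => //.
      by apply: hK; rewrite !ltW.
    by apply: hC; rewrite x0.
  + move=> x [x0 x1]; rewrite !lte_fin in x0 x1.
    apply: (is_derive_eq (is_derive_cmul (K * C) (is_derive_add
      (is_derive_opp (is_derive_cmul D1 (dm x (e1 + 1) x1)))
      (is_derive_cmul D2 (dp x (e2 + 1) x0))))).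
    rewrite !addrK /D1 /D2; field.
    by rewrite !gt_eqF.
  + move=> x [x0 x1]; rewrite !lte_fin in x0 x1; have [xm xp] := pos x x0 x1.
    have KC : 0 <= K * C by rewrite mulr_ge0.
    rewrite normrM (ger0_norm KC) ler_wpM2l// ler_norml.
    have q1 : D1 * (1 - x) `^ (e1 + 1) <= D1 * 2 `^ (e1 + 1).
      by rewrite ler_wpM2l ?(ltW D10)//; apply: pow2 => //; lra.
    have q2 : D2 * (1 + x) `^ (e2 + 1) <= D2 * 2 `^ (e2 + 1).
      by rewrite ler_wpM2l ?(ltW D20)//; apply: pow2 => //; lra.
    have r1 : 0 <= D1 * (1 - x) `^ (e1 + 1) by rewrite mulr_ge0 ?powR_ge0 ?ltW.
    have r2 : 0 <= D2 * (1 + x) `^ (e2 + 1) by rewrite mulr_ge0 ?powR_ge0 ?ltW.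
    by apply/andP; split; lra.
Qed.

End NormalFormSegment.

(** * The classification *)

Section Classification.
Variable R : realType.
Implicit Types (l r : \bar R) (L M : diffop R) (p w : R -> R) (P : {poly R}).

Lemma itv_half_line (t : R) : itv_of 0%:E +oo%E t <-> `]0, +oo[%classic t.
Proof. by rewrite /itv_of /= in_itv /= andbT lte_fin ltry; split=> [[]|]. Qed.

Lemma itv_segment (t : R) : itv_of (-1)%:E 1%:E t <-> `](-1), 1[%classic t.
Proof. by rewrite /itv_of /= in_itv /= !lte_fin; split=> [[-> ->]|/andP[]]. Qed.

Lemma same_upto_affine_reduced L l r p M l' r' w (J : set R) :
  (forall t, itv_of l' r' t <-> J t) ->
  same_upto_affine L (itv_of l r) p M J w -> reduced M l' r' w -> reduced L l r p.
Proof.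
move=> JE [alpha [beta [c [k [[alpha0 c0 k0] IE pw app]]]]] redM.
have coefs := proj2 (same_coefsP beta c L M alpha0) app.
apply: (reduced_affine alpha0 c0 k0 coefs _ _ redM) => t.
- rewrite JE IE; split=> [Jt|[s Js]]; first by exists t.
  by move=> /addIr/(mulfI alpha0) <-.
- by move=> /JE; exact: pw.
Qed.

Lemma reduced_same_upto_affine L l r p M l' r' w (J : set R) (alpha beta c k : R) :
  alpha != 0 -> c != 0 -> 0 < k ->
  (forall t, itv_of l' r' t <-> J t) ->
  (forall t, itv_of l' r' t <-> itv_of l r (alpha * t + beta)) ->
  same_coefs 1 0 c (pullback alpha beta L) M ->
  (forall t, itv_of l' r' t -> p (alpha * t + beta) = k * w t) ->
  same_upto_affine L (itv_of l r) p M J w /\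
  forall t, root (a4 L) (alpha * t + beta) = root (a4 M) t.
Proof.
move=> alpha0 c0 k0 JE IE e pw.
have coefs : same_coefs alpha beta c L M.
  have [e4 e3 e2 e1] := same_coefs_pullback beta L alpha0.
  have X1 : affX 1 0 = 'X :> {poly R} by rewrite /affX scale1r addr0.
  move: e => [f4 f3 f2 f1]; rewrite X1 !comp_polyXr !expr1n !mulr1 in f4 f3 f2 f1.
  split; rewrite ?e4 ?e3 ?e2 ?e1 ?f4 ?f3 ?f2 ?f1 scalerA mul1r mulrC//.
split; last by move=> t; exact: (root_affine alpha0 c0 coefs t).
exists alpha, beta, c, k; split=> //.
- apply/seteqP; split=> [x Ix|_ [t /JE/IE It <-]]//.
  exists (alpha^-1 * x + - beta / alpha); last by field.
  by apply/JE/IE; rewrite (_ : _ + beta = x)//; field.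
- by move=> t /JE; exact: pw.
- exact: (proj1 (same_coefsP beta c L M alpha0) coefs).
Qed.

Lemma reduced_caseB L l r p (s x : R) : s != 0 ->
  (forall t, itv_of 0%:E +oo%E t <-> itv_of l r (s * t + x)) ->
  reduced L l r p -> caseB L (itv_of l r) p.
Proof.
move=> s0 IE redL; have redM := reduced_pullback s0 IE redL.
have [a [b [A [c [k [ab c0 k0 e pk]]]]]] := reduced_half_line redM.
have [same rE] := reduced_same_upto_affine s0 c0 k0 itv_half_line IE e pk.
split; last by exists a, b, A.
exists x; split.
- by have := rE 0; rewrite mulr0 add0r => ->; rewrite /root hornerXn expr0n.
- move=> y; have -> : y = s * (s^-1 * (y - x)) + x by field.
  rewrite rE /root hornerXn expf_eq0 mulf_eq0 invr_eq0 (negPf s0) /= => /eqP ->.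
  by rewrite mulr0 mulr0 add0r.
Qed.

Lemma reduced_cases L l r p : reduced L l r p ->
  [\/ caseA L (itv_of l r) p, caseB L (itv_of l r) p | caseC L (itv_of l r) p].
Proof.
case: l r => [x| |] [y| |] redL; have [lr rL rl rr] := red_itv redL.
- constructor 3; move: lr; rewrite lte_fin => xy.
  pose alpha := (y - x) / 2; pose beta := (x + y) / 2.
  have alpha0 : 0 < alpha by rewrite /alpha; lra.
  have IE t : itv_of (-1)%:E 1%:E t <-> itv_of x%:E y%:E (alpha * t + beta).
    have h1 : (x < alpha * t + beta) = (-1 < t).
      rewrite -subr_gt0 (_ : _ - x = alpha * (t + 1)); last by rewrite /alpha /beta; field.
      by rewrite pmulr_rgt0// -ltrBlDr sub0r.
    have h2 : (alpha * t + beta < y) = (t < 1).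
      rewrite -subr_gt0 (_ : y - _ = alpha * (1 - t)); last by rewrite /alpha /beta; field.
      by rewrite pmulr_rgt0// subr_gt0.
    by rewrite /itv_of /= !lte_fin h1 h2.
  have a0 : alpha != 0 by rewrite gt_eqF.
  have redM := reduced_pullback a0 IE redL.
  have [a [b [m [c [k [ab c0 k0 e pk]]]]]] := reduced_segment redM.
  have [same _] := reduced_same_upto_affine a0 c0 k0 itv_segment IE e pk.
  split; first by exists x, y; split; [rewrite lt_eqF|exact: rl|exact: rr].
  exists a, b; split=> //; have [b0|b0] := eqVneq b 0.
  + left; split=> //; exists (m + (a - 1) * (a - 2)).
    by move: same; rewrite opC0E addrK b0.
  + right; split=> //; exists (- m * b); rewrite opCE//.
    by rewrite (_ : - (- m * b) / b = m)//; field.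
- constructor 2; apply: (@reduced_caseB _ _ _ _ 1 x) => //.
  by move=> t; rewrite /itv_of /= mul1r !lte_fin !ltry ltrDr.
- by move: lr; rewrite ltNge leNye.
- by move: lr; rewrite ltNge leey.
- by move: lr; rewrite ltxx.
- by move: lr; rewrite ltNge leey.
- constructor 2; apply: (@reduced_caseB _ _ _ _ (-1) y) => //.
  move=> t; rewrite /itv_of /= mulN1r !lte_fin ltry ltNyr addrC ltrBlDr ltrDl.
  by split=> -[].
- constructor 1; have IT : itv_of -oo%E +oo%E = setT :> set R.
    by apply/seteqP; split=> // x _; split; rewrite ?ltNyr ?ltry.
  split=> //; first by move=> x; apply: rL; rewrite IT.
  have [m0 [m1 [m2 [A [c [m20 c0 pE e]]]]]] := reduced_line redL.
  exists m0, m1, m2, A, c; split=> // u.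
  have := proj1 (same_coefsP 0 c L (opA m1 m2 A) (oner_neq0 R)) e u.
  by rewrite /affX scale1r addr0 !comp_polyXr.
- by move: lr; rewrite ltxx.
Qed.

Lemma caseA_reduced L l r p : caseA L (itv_of l r) p -> reduced L l r p.
Proof.
move=> [_ IT [m0 [m1 [m2 [A [c [m20 c0 pE app]]]]]]].
apply: (@same_upto_affine_reduced _ _ _ _ (opA m1 m2 A) -oo%E +oo%E (wA m0 m1 m2) setT).
- by move=> t; split=> // _; split; rewrite ?ltNyr ?ltry.
- exists 1, 0, c, 1; split=> //.
  + by rewrite IT; apply/seteqP; split=> // x _; exists x => //; rewrite mul1r addr0.
  + by move=> t _; rewrite !mul1r addr0.
  + by move=> u; rewrite /affX scale1r addr0 !comp_polyXr.
- exact: reduced_opA.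
Qed.

Lemma caseB_reduced L l r p : caseB L (itv_of l r) p -> reduced L l r p.
Proof.
move=> [_ [a [b [A [ab same]]]]].
exact: (same_upto_affine_reduced itv_half_line same (reduced_opB A ab)).
Qed.

Lemma caseC_reduced L l r p : caseC L (itv_of l r) p -> reduced L l r p.
Proof.
move=> [_ [a [b [ab [[b0 [A same]]|[b0 [B same]]]]]]].
- rewrite opC0E in same; rewrite b0 in ab same.
  exact: (same_upto_affine_reduced itv_segment same (reduced_opCm _ ab)).
- rewrite opCE// in same.
  exact: (same_upto_affine_reduced itv_segment same (reduced_opCm _ ab)).
Qed.

End Classification.

Section Eigenvalues.
Variable R : realType.
Implicit Types (L : diffop R) (P : {poly R}) (n k : nat).

Lemma natr_ffactS n k : (n ^_ k.+1)%:R = (n ^_ k)%:R * (n%:R - k%:R) :> R.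
Proof.
rewrite ffactnSr natrM; have [kn|nk] := leqP k n; first by rewrite natrB.
by rewrite (ffact_small nk) !mul0r.
Qed.

Lemma coef_mul_derivnXn P n k :
  (P * ('X^n)^`(k))`_n = P`_k * (n ^_ k)%:R.
Proof.
rewrite derivnXn mulrnAr coefMn coefMXn mulr_natr.
have [kn|nk] := leqP k n; last by rewrite ffact_small.
by rewrite ltnNge leq_subr /= subKn.
Qed.

Lemma eigvalE L n : eigval L n =
  (a4 L)`_4 * (n%:R * (n%:R - 1) * (n%:R - 2) * (n%:R - 3))
  + (a3 L)`_3 * (n%:R * (n%:R - 1) * (n%:R - 2))
  + (a2 L)`_2 * (n%:R * (n%:R - 1)) + (a1 L)`_1 * n%:R.
Proof.
rewrite /eigval /diffop_app -derivn1 !coefD !coef_mul_derivnXn !natr_ffactS.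
by rewrite ffactn0 /= !mul1r subr0.
Qed.

Lemma eigval_opA (m1 m2 A : R) n : eigval (opA m1 m2 A) n = lambdaA m1 m2 A n.
Proof.
rewrite eigvalE /lambdaA /opA /=.
rewrite !(coefZ, coefN, coefD, coefC, coefX, coefXn, coef1) /=.
by ring.
Qed.

Lemma eigval_opB (a b A : R) n : eigval (opB a b A) n = lambdaB a b A n.
Proof.
rewrite eigvalE /lambdaB /opB /=.
rewrite !(coefZ, coefN, coefD, coefC, coefX, coefXn, coefXM) /=.
by field.
Qed.

Lemma eigval_opCm (a b m : R) n : eigval (opCm a b m) n =
  n%:R * (n%:R - 1 - a) * ((n%:R - 1) * (n%:R - a) + m).
Proof.
have [E4 E3 E2 E1] := opCm_monomials a b m.
rewrite eigvalE E4 E3 E2 E1 !(coefD, coefZ, coefC, coefX, coefXn) /=.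
by ring.
Qed.

End Eigenvalues.

Theorem mainTheorem6 (R : realType) :
  (forall (L : diffop R) (l r : \bar R) (p : R -> R),
     selfadjoint_admissible L l r p <->
     [\/ caseA L (itv_of l r) p, caseB L (itv_of l r) p
       | caseC L (itv_of l r) p]) /\
  [/\ (forall (m1 m2 A : R), m2 != 0 ->
         forall n : nat, eigval (opA m1 m2 A) n = lambdaA m1 m2 A n),
      (forall (a b A : R), paramB a b ->
         forall n : nat, eigval (opB a b A) n = lambdaB a b A n),
      (forall (a A : R), paramC a 0 ->
         forall n : nat, eigval (opC0 a A) n = lambdaC0 a A n) &
      (forall (a b B : R), paramC a b -> b != 0 ->
         forall n : nat, eigval (opC a b B) n = lambdaC a b B n)].
Proof.
split.
  move=> L l r p; rewrite reducedP; split; first exact: reduced_cases.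
  by case; [exact: caseA_reduced|exact: caseB_reduced|exact: caseC_reduced].
split.
- by move=> m1 m2 A _ n; exact: eigval_opA.
- by move=> a b A _ n; exact: eigval_opB.
- by move=> a A _ n; rewrite opC0E eigval_opCm /lambdaC0; ring.
- by move=> a b B _ b0 n; rewrite opCE// eigval_opCm /lambdaC; field.
Qed.
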